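(* Let $h$ be a random tornado tabulation hash function with $d$ derived characters, $\varphi$ a selector with $\mu=\mathbb E|X|\le|\Sigma|/2$, and $S_i,\bar h,\mathcal J,f,\bar\mu_i$ as in the context; let $S_{\le3}=S_1+S_2+S_3$. Let $s_{sec}>0$ and $0<p<1$ satisfy $\ln(s_{sec}/p)\le\bar\mu_3$, and let \[ \varepsilon_3=(2+\sqrt6)\sqrt{\ln(s_{sec}/p)/|\Sigma|}+\big(\tfrac12\ln(1/p)+6\big)/\mu . \] Then \[ \Pr\Big[S_{\le3}\le\mathbb E[S_{\le3}\mid\bar h]-\sqrt{\tfrac73\ln(1/p)\,\mu\,(1+\varepsilon_3)}-\ln(1/p)\Big]<\Big(1+\frac{4}{s_{sec}}\Big)p+4\Pr[\neg\mathcal J]. \]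
   Context: $\Sigma$ is identified with $k$-bit strings under XOR, $\mathcal R=[2^r]$ with $r$-bit strings. Simple tabulation $g:\Sigma^m\to\mathcal R'$: independent fully random tables, $g(y)=\bigoplus_jT_j[y_j]$. Tornado tabulation with $d$ derived characters: derived key $\tilde x\in\Sigma^{c+d}$ of $x=x_1\cdots x_c$ has $\tilde x_i=x_i$ ($i<c$), $\tilde x_c=x_c\oplus h_0(x_1\cdots x_{c-1})$, $\tilde x_{c+i}=\tilde h_i(\tilde x_1\cdots\tilde x_{c+i-1})$ ($1\le i\le d$), $h_0,\tilde h_i$ simple tabulation into $\Sigma$; $h(x)=\hat h(\tilde x)$ for simple tabulation $\hat h$ with tables $\hat T_1,\dots,\hat T_{c+d}$; all tables independent. Selector $\varphi:\Sigma^c\times\mathcal R\to\{0,1\}$, $\varphi(x,r)$ depending only on $x$ and fixed bits of $r$; $X=\{x:\varphi(x,h(x))=1\}$, $\mu=\mathbb E|X|$, $f=\mu/|\Sigma|$, $\bar\mu_i=|\Sigma|f^i/i!$. $\bar h(x)=(\bar h[0](x),\bar h[1](x))$ with $\bar h[1](x)=\tilde x_{c+d}$, $\bar h[0](x)=\bigoplus_{j<c+d}\hat T_j[\tilde x_j]$; $\mathbb E[\cdot\mid\bar h]$ is conditional on the random function $\bar h$. $X_\alpha=\{x\in X:\tilde x_{c+d}=\alpha\}$, $S_i=|\{\alpha\in\Sigma:|X_\alpha|\ge i\}|$. A family of keys (viewed as sets of position characters) is linearly independent if no nonempty subfamily has every position character occurring an even number of times; $\mathcal J$ is the event that $(\tilde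 x_1\cdots\tilde x_{c+d-1})_{x\in X}$ is linearly independent. *)

(* Defs.v *)
From mathcomp Require Import all_boot all_order all_algebra.
From mathcomp Require Import reals exp.

Set Implicit Arguments.
Unset Strict Implicit.
Unset Printing Implicit Defensive.

Import Order.TTheory GRing.Theory Num.Theory.
Local Open Scope ring_scope.

(* k-bit strings; XOR is the addition of the row vectors over 'F_2. *)
Notation bits k := 'rV['F_2]_k.

(* Uniform probability on a finite sample space. *)
Definition prob (R : realType) (T : finType) (E : {set T}) : R :=
  #|E|%:R / #|T|%:R.

Definition mean (R : realType) (T : finType) (Y : T -> R) : R :=
  (\sum_w Y w) / #|T|%:R.

(* The random variable E[Y | Z], evaluated at the outcome [w]. *)
Definition cond_mean (R : realType) (T : finType) (V : eqType)
    (Y : T -> R) (Z : T -> V) (w : T) : R :=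
  (\sum_(w' | Z w' == Z w) Y w') / #|[set w' | Z w' == Z w]|%:R.

Definition simple_tables (m k r : nat) : finType :=
  {ffun 'I_m -> {ffun bits k -> bits r}}.

Definition simple_tab (m k r : nat) (T : simple_tables m k r)
    (y : m.-tuple (bits k)) : bits r :=
  \sum_(j < m) T j (tnth y j).

(* The tables of h_0, of the functions computing the derived characters, and of
   the top function.  Positions are numbered from 0, so that the i-th component
   (i < d) of the second factor holds the function of c + i characters that
   computes the character at position c + i.  Choosing all the tables
   independently and uniformly is the uniform probability on this type. *)
Definition tornado (c d k r : nat) : finType :=
  (simple_tables c.-1 k k
   * {dffun forall i : 'I_d, simple_tables (c + i) k k}
   * simple_tables (c + d) k r)%type.

Definition h0_tables (c d k r : nat) (w : tornado c d k r) := w.1.1.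
Definition derived_tables (c d k r : nat) (w : tornado c d k r) := w.1.2.
Definition top_tables (c d k r : nat) (w : tornado c d k r) := w.2.

Definition prefix_key (k m : nat) (s : seq (bits k)) : m.-tuple (bits k) :=
  [tuple s`_j | j < m].

Definition derived_seq (c d k r : nat) (w : tornado c d k r)
    (x : c.-tuple (bits k)) : seq (bits k) :=
  foldl
    (fun s (i : 'I_d) =>
       rcons s (simple_tab (derived_tables w i) (prefix_key (c + i) s)))
    (rcons (take c.-1 x)
       (x`_c.-1 + simple_tab (h0_tables w) (prefix_key c.-1 x)))
    (enum 'I_d).

(* The derived key; [derived_seq w x] has size c + d as soon as 0 < c. *)
Definition derived_key (c d k r : nat) (w : tornado c d k r)
    (x : c.-tuple (bits k)) : (c + d).-tuple (bits k) :=
  prefix_key (c + d) (derived_seq w x).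

Definition tornado_hash (c d k r : nat) (w : tornado c d k r)
    (x : c.-tuple (bits k)) : bits r :=
  simple_tab (top_tables w) (derived_key w x).

Definition last_char (c d k r : nat) (w : tornado c d k r)
    (x : c.-tuple (bits k)) : bits k :=
  (derived_key w x)`_(c + d).-1.

(* The random function (hbar[0], hbar[1]). *)
Definition hbar (c d k r : nat) (w : tornado c d k r) :
    {ffun c.-tuple (bits k) -> bits r * bits k} :=
  [ffun x =>
     (\sum_(j < c + d | (j < (c + d).-1)%N)
         top_tables w j (tnth (derived_key w x) j),
      last_char w x)].

(* [phi x v] depends only on [x] and on the bits of [v] indexed by [B]. *)
Definition selector (c k r : nat) (B : {set 'I_r})
    (phi : c.-tuple (bits k) -> bits r -> bool) : Prop :=
  forall (x : c.-tuple (bits k)) (u v : bits r),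
    (forall b, b \in B -> u 0 b = v 0 b) -> phi x u = phi x v.

Definition selected (c d k r : nat) (phi : c.-tuple (bits k) -> bits r -> bool)
    (w : tornado c d k r) : {set c.-tuple (bits k)} :=
  [set x | phi x (tornado_hash w x)].

Definition selected_last (c d k r : nat)
    (phi : c.-tuple (bits k) -> bits r -> bool)
    (w : tornado c d k r) (a : bits k) : {set c.-tuple (bits k)} :=
  [set x in selected phi w | last_char w x == a].

Definition S_ (c d k r : nat) (phi : c.-tuple (bits k) -> bits r -> bool)
    (i : nat) (w : tornado c d k r) : nat :=
  #|[set a | (i <= #|selected_last phi w a|)%N]|.

Definition S_le3 (R : realType) (c d k r : nat)
    (phi : c.-tuple (bits k) -> bits r -> bool) (w : tornado c d k r) : R :=
  (S_ phi 1 w + S_ phi 2 w + S_ phi 3 w)%:R.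

Definition position_chars (k m : nat) (y : m.-tuple (bits k)) :
    {set 'I_m * bits k} :=
  [set (j, tnth y j) | j : 'I_m].

(* Independence of the indexed family (y i), i in A: equal keys at distinct
   indices make the family dependent. *)
Definition lin_indep (k m : nat) (I : finType) (A : {set I})
    (y : I -> m.-tuple (bits k)) : bool :=
  ~~ [exists B : {set I},
        [&& B \subset A, B != set0 &
            [forall a : 'I_m * bits k,
               ~~ odd #|[set i in B | a \in position_chars (y i)]|]]].

Definition J_event (c d k r : nat) (phi : c.-tuple (bits k) -> bits r -> bool) :
    {set tornado c d k r} :=
  [set w | lin_indep (selected phi w)
             (fun x => prefix_key (c + d).-1 (derived_key w x))].

Definition mu (R : realType) (c d k r : nat)
    (phi : c.-tuple (bits k) -> bits r -> bool) : R :=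
  mean (fun w : tornado c d k r => #|selected phi w|%:R).

Definition sigma_card (R : realType) (k : nat) : R := #|{: bits k}|%:R.

Definition f_ (R : realType) (c d k r : nat)
    (phi : c.-tuple (bits k) -> bits r -> bool) : R :=
  mu R d phi / sigma_card R k.

Definition mubar (R : realType) (c d k r : nat)
    (phi : c.-tuple (bits k) -> bits r -> bool) (i : nat) : R :=
  sigma_card R k * f_ R d phi ^+ i / i`!%:R.

Definition eps3 (R : realType) (c d k r : nat)
    (phi : c.-tuple (bits k) -> bits r -> bool) (s_sec p : R) : R :=
  (2 + Num.sqrt 6) * Num.sqrt (ln (s_sec / p) / sigma_card R k)
  + (2^-1 * ln (1 / p) + 6) / mu R d phi.

(* Main.v *)
Require Import Defs.
From mathcomp Require Import all_boot all_order all_algebra.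
From mathcomp Require Import ring lra zify.
From mathcomp Require Import reals topology normedtype sequences derive realfun exp.

Set Implicit Arguments.
Unset Strict Implicit.
Unset Printing Implicit Defensive.

Import Order.TTheory GRing.Theory Num.Theory.
Import numFieldNormedType.Exports.
Local Open Scope ring_scope.

(* Write n = |Sigma|, L = ln (1 / p), l = ln (s_sec / p) and N_a = |X_a|.  Given
   hbar, the table of the last character is still uniform, so the N_a are
   independent and E[|X| | hbar] is exactly mu.  Hence S_{<=3} is a sum of the
   independent variables min(N_a, 3) of total mean y <= mu <= n / 2, and, as
   min(N, 3)^2 = [N >= 1] + 3 [N >= 2] + 5 [N >= 3], Cauchy-Schwarz bounds the
   conditional variance by y - y^2 / n + 2 E[S_2 | hbar] + 4 E[S_3 | hbar].
   Bernstein's inequality costs the term p, provided that E[S_i | hbar] is less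
   than mubar_i + sqrt (3 mubar_i l) + 1 for i = 2, 3: the leading terms of the
   variance are then at most mu - mu^2 / n + mu^2 / n + mu / 6 = 7/6 mu.

   If that bound on E[S_i | hbar] fails, then S_i >= mubar_i + sqrt (3 mubar_i l)
   with conditional probability at least 1/2, because a sum of independent
   Bernoulli variables of mean at least k (k an integer) is at least k with
   probability at least 1/2.  Together with J this event has probability less than
   p / s_sec by Chernoff: on J the selected keys have independent prefixes, so that
   their hash values and last characters behave as if fully random and
   E[(1 + x)^{S_i}; J] <= (1 + x f^i / i!)^n. *)

(** * Exponential and logarithm bounds *)

Lemma ge0_derive_le (R : realType) (f df : R -> R) (a b : R) :
    a <= b -> (forall x, a <= x <= b -> is_derive x 1 f (df x)) ->
    (forall x, a <= x <= b -> 0 <= df x) ->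
  f a <= f b.
Proof.
move=> leab fdf df_ge0.
apply: (@ger0_derive1_le_cc _ f a b) => //; last 2 first.
- by rewrite in_itv /= lexx.
- by rewrite in_itv /= lexx leab.
- move=> x; rewrite in_itv /= => /andP[/ltW ax /ltW xb].
  by have := fdf x; rewrite ax xb => /(_ isT) [].
- move=> x; rewrite in_itv /= => /andP[/ltW ax /ltW xb].
  have := fdf x; rewrite ax xb => /(_ isT) fx; rewrite derive1E derive_val.
  by apply: df_ge0; rewrite ax xb.
apply: derivable_within_continuous => x; rewrite in_itv /= => /fdf [].
by [].
Qed.

(* The right-hand side over 6 - 2x is a Pade approximant of exp; it equals
   1 + x + (x ^+ 2 / 2) / (1 - x / 3). *)
Lemma expR_pade (R : realType) (x : R) :
  expR x * (6 - 2 * x) <= 6 + 4 * x + x ^+ 2.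
Proof.
(* [g] and its derivative [g1] both vanish at 0, and [g1] is nondecreasing because e^(-z) >= 1 - z;
   hence [g1] has the sign of its argument and [g] is minimal at 0. *)
pose g (x : R) := 6 + 4 * x + x ^+ 2 - expR x * (6 - 2 * x).
pose g1 (x : R) := 4 + 2 * x - expR x * (4 - 2 * x).
have dg (z : R) : is_derive z 1 g (g1 z).
  apply: is_derive_eq; rewrite /g1 /GRing.scale /=; ring.
have dg1 (z : R) : is_derive z 1 g1 (2 * (1 - expR z * (1 - z))).
  apply: is_derive_eq; rewrite /GRing.scale /=; ring.
have dg1_ge0 (z : R) : 0 <= 2 * (1 - expR z * (1 - z)).
  have := expR_ge1Dx (- z); rewrite -(ler_pM2l (expR_gt0 z)) expRxMexpNx_1.
  by move: (expR z) => e; nra.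
have g10 : g1 0 = 0 by rewrite /g1 expR0; ring.
have g0 : g 0 = 0 by rewrite /g expR0; ring.
suff : 0 <= g x by rewrite /g subr_ge0.
case: (leP 0 x) => x0.
  rewrite -g0; apply: (@ge0_derive_le _ g g1) => // z /andP[z0 _].
  by rewrite -g10; apply: (@ge0_derive_le _ g1 _ 0 z z0).
rewrite -lerN2 -g0.
apply: (@ge0_derive_le _ (fun x => - g x) (fun x => - g1 x) x 0); first exact: ltW.
move=> z /andP[_ z0]; rewrite oppr_ge0 -g10.
exact: (@ge0_derive_le _ g1 _ z 0 z0).
Qed.

(** [expR_pade] at 1/2 gives e^(1/2) <= 33/20, whose square is 2.7225; the rounded constant 2.73 is
    still below 1 + sqrt 3. *)
Lemma expR1_lt (R : realType) : expR 1 < 273 / 100 :> R.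
Proof.
have := @expR_pade R (2^-1); have := expR_ge0 (2^-1 : R).
have -> : expR (1 : R) = expR 2^-1 * expR 2^-1 by rewrite -expRD; congr expR; lra.
move: (expR _) => e; nra.
Qed.

Lemma is_derive_ln1D (R : realType) (x : R) :
  -1 < x -> is_derive x 1 (fun z => ln (1 + z)) (1 + x)^-1.
Proof.
move=> x1; have x1_gt0 : 0 < 1 + x by lra.
have dln := is_derive1_ln x1_gt0.
have d1D : is_derive x 1 (fun z : R => 1 + z) 1.
  by apply: is_derive_eq; rewrite add0r mulr1.
have := @is_derive1_comp _ _ _ x _ _ dln d1D; rewrite mulr1; exact.
Qed.

(** The difference of the two sides vanishes at 0 and has derivative z^2 / ((1 + z) (2 + z)^2). *)
Lemma ln1D_pade (R : realType) (x : R) :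
  0 <= x -> 2 * x / (2 + x) <= ln (1 + x).
Proof.
move=> x0; pose g (x : R) := ln (1 + x) - 2 * x / (2 + x).
have -> : (2 * x / (2 + x) <= ln (1 + x)) = (g 0 <= g x).
  by rewrite /g addr0 ln1 mulr0 mul0r subr0 subr_ge0.
apply: (@ge0_derive_le _ g (fun z => (1 + z)^-1 - 4 / (2 + z) ^+ 2)) => //.
  move=> z /andP[z0 _].
  have z1 : -1 < z by lra.
  have z2 : 2 + z != 0 by lra.
  have d1 := is_derive_ln1D z1.
  have d2 : is_derive z 1 (fun z : R => 2 * z / (2 + z)) (4 / (2 + z) ^+ 2).
    apply: is_derive_eq; rewrite /GRing.scale /=; field.
    by [].
  by apply: is_derive_eq.
move=> z /andP[z0 _].
have -> : (1 + z)^-1 - 4 / (2 + z) ^+ 2 = z ^+ 2 / ((1 + z) * (2 + z) ^+ 2).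
  by field; apply/andP; split; lra.
by rewrite divr_ge0 ?sqr_ge0 // mulr_ge0 ?sqr_ge0//; lra.
Qed.

(* ((1 + x) ln (1 + x) - x) / x ^+ 2 is nonincreasing, and exceeds 1/3 at
   x = sqrt 3 because e < 1 + sqrt 3. *)
Lemma chernoff_rate_gt (R : realType) (x : R) :
  0 < x -> x ^+ 2 <= 3 -> x ^+ 2 / 3 < (1 + x) * ln (1 + x) - x.
Proof.
move=> x0 x3; pose g (x : R) := ((1 + x) * ln (1 + x) - x) / x ^+ 2.
pose s : R := Num.sqrt 3.
have s0 : 0 < s by rewrite sqrtr_gt0.
have s2 : s ^+ 2 = 3 by rewrite sqr_sqrtr.
have xs : x <= s by rewrite -(ler_pXn2r (n := 2)) ?nnegrE ?s2//; exact: ltW.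
have gs : 3^-1 < g s.
  have e_lt : expR 1 < 1 + s by have := @expR1_lt R; nra.
  have : ln (expR 1) < ln (1 + s) by rewrite ltr_ln ?posrE ?expR_gt0 ?addr_gt0.
  rewrite expRK => ln_gt1.
  rewrite /g s2 ltr_pdivlMr// mulVf//; nra.
(* The numerator of the derivative of [- g] is nonnegative by exactly the bound of [ln1D_pade]. *)
have : g s <= g x.
  rewrite -lerN2.
  apply: (@ge0_derive_le _ (fun z => - g z)
    (fun z => ((2 + z) * ln (1 + z) - 2 * z) / z ^+ 3)) => //.
    move=> z /andP[xz _].
    have z1 : -1 < z by lra.
    have z0 : z ^+ 2 != 0 by rewrite sqrf_eq0; lra.
    have d1 := is_derive_ln1D z1.
    rewrite /g; apply: is_derive_eq; rewrite /GRing.scale /=; field.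
    by apply/andP; split; lra.
  move=> z /andP[xz _]; rewrite divr_ge0 ?exprn_ge0//; last by lra.
  have : 0 <= z by lra.
  move/ln1D_pade; rewrite ler_pdivrMr; first by lra.
  by lra.
move=> gsx; have : 3^-1 < g x by exact: lt_le_trans gsx.
by rewrite /g ltr_pdivlMr ?exprn_gt0// mulrC.
Qed.

(** * The median of a sum of independent Bernoulli variables *)

(** If i0 is the first index with a negative value, then i D(i) <= i0 D(i) for every i, because i -
    i0 and D(i) have opposite signs. The hypothesis at 0 makes i0 positive, so that it can be
    divided out. *)
Lemma sum_ge0_single_crossing (R : realFieldType) (N : nat) (D : nat -> R) :
    0 <= D 0%N ->
    (forall i j, (i <= j)%N -> D i < 0 -> D j <= 0) ->
    0 <= \sum_(i < N) i%:R * D i ->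
  0 <= \sum_(i < N) D i.
Proof.
move=> D0 cross first_moment.
have [/existsP [i Di]|] := boolP [exists i : 'I_N, D i < 0]; last first.
  by rewrite negb_exists => /forallP D_ge0; apply: sumr_ge0 => i _; rewrite leNgt.
have exD : exists i, D i < 0 by exists i.
case: (ex_minnP exD) => i0 Di0 min_i0.
have i0_gt0 : 0 < i0%:R :> R.
  by rewrite ltr0n lt0n; apply: contraTneq Di0 => ->; rewrite -leNgt.
rewrite -(pmulr_rge0 _ i0_gt0) mulr_sumr; apply: le_trans first_moment _.
apply: ler_sum => j _; have [le_i0j|lt_ji0] := leqP i0 j.
  by rewrite ler_wnM2r ?(cross i0) // ler_nat.
rewrite ler_wpM2r ?ler_nat 1?ltnW //.
by rewrite leNgt; apply: contraL lt_ji0 => /min_i0; rewrite -leqNgt.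
Qed.

Section IntegerMeanBinomial.
Variables (R : realFieldType) (k m : nat).
Hypotheses (k_gt0 : (0 < k)%N) (m_gt0 : (0 < m)%N).
Let n := (k + m)%N.

(* n ^+ n times the probability that a binomial variable with parameters n and
   k / n equals j. *)
Let t (j : nat) : R := 'C(n, j)%:R * (k%:R ^+ j * m%:R ^+ (n - j)).
(** [u] reads the terms upwards from the mean k and [v] downwards from k - 1, padded with 0; the
    median inequality becomes a comparison of their sums. *)
Let u i := t (k + i).
Let v i := if (i < k)%N then t (k.-1 - i) else 0.

Let t_ge0 j : 0 <= t j.
Proof. by rewrite !mulr_ge0 ?exprn_ge0. Qed.

Let u_ge0 i : 0 <= u i.
Proof. exact: t_ge0. Qed.

Let t_gt0 j : (j <= n)%N -> 0 < t j.
Proof. by move=> jn; rewrite !mulr_gt0 ?exprn_gt0 ?ltr0n ?bin_gt0. Qed.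

Let t_eq0 j : (n < j)%N -> t j = 0.
Proof. by move=> nj; rewrite /t bin_small // mul0r. Qed.

Let t_rec j : t j.+1 * j.+1%:R * m%:R = t j * (n%:R - j%:R) * k%:R.
Proof.
have [jn|nj] := ltnP j n; last first.
  rewrite t_eq0 // !mul0r; move: nj; rewrite leq_eqVlt => /orP[/eqP<-|nj].
    by rewrite subrr mulr0 mul0r.
  by rewrite t_eq0 // !mul0r.
have /(congr1 (fun i => i%:R : R)) := mul_bin_left n j.
rewrite !natrM natrB ?(ltnW jn) // => bin_rec.
rewrite /t -(subnSK jn) !exprS.
transitivity (j.+1%:R * 'C(n, j.+1)%:R * (k%:R * k%:R ^+ j * m%:R ^+ (n - j.+1) * m%:R) : R).
  by ring.
by rewrite bin_rec; ring.
Qed.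

(** Summing [t_rec] over j and using n = k + m leaves n times the first central moment. *)
Let mean_t : \sum_(j < n.+1) (j%:R - k%:R) * t j = 0.
Proof.
have n_gt0 : n%:R != 0 :> R by rewrite pnatr_eq0 /n; lia.
apply: (mulfI n_gt0); rewrite mulr0 mulr_sumr.
have sum_rec : \sum_(j < n.+1) t j * j%:R * m%:R
             = \sum_(j < n.+1) t j * (n%:R - j%:R) * k%:R.
  rewrite big_ord_recl mulr0 mul0r add0r big_ord_recr /= subrr mulr0 mul0r addr0.
  by apply: eq_bigr => j _; rewrite -t_rec /bump add1n.
move/eqP: sum_rec; rewrite -subr_eq0 -sumrB => /eqP sum0; rewrite -[RHS]sum0.
by apply: eq_bigr => j _; rewrite {1 2}/n natrD; ring.
Qed.

Let sum_low (F : nat -> R) : \sum_(j < k) F j * t j = \sum_(i < n.+1) F (k.-1 - i)%N * v i.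
Proof.
have kn : (k <= n.+1)%N by rewrite /n; lia.
rewrite (reindex_inj rev_ord_inj) /=.
transitivity (\sum_(i < k) F (k.-1 - i)%N * v i).
  apply: eq_bigr => i _; rewrite /v ltn_ord.
  by have -> : (k - i.+1 = k.-1 - i)%N by lia.
rewrite (big_ord_widen _ (fun i => F (k.-1 - i)%N * v i) kn) big_mkcond.
by apply: eq_bigr => i _; rewrite /v; case: ltnP; rewrite ?mulr0.
Qed.

Let sum_high (F : nat -> R) :
  \sum_(k <= j < n.+1) F j * t j = \sum_(i < n.+1) F (k + i)%N * u i.
Proof.
rewrite -{1}(addn0 k) addnC big_addn.
rewrite -[RHS](big_mkord xpredT (fun i => F (k + i)%N * u i)).
have le1 : (n.+1 - k <= n.+1)%N by lia.
rewrite [RHS](big_cat_nat (leq0n (n.+1 - k)) le1) /= [X in _ = _ + X]big1_seq ?addr0.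
  by apply: eq_bigr => i _; rewrite addnC.
move=> i /andP[_]; rewrite mem_index_iota => /andP[le_i _].
by rewrite /u t_eq0 ?mulr0 //; lia.
Qed.

(** Centred at k, [u i] has weight i and [v i] has weight -(i + 1), so [mean_t] turns this sum into
    the sum of the [v i]. *)
Let first_moment : 0 <= \sum_(i < n.+1) i%:R * (u i - v i).
Proof.
have kn : (k <= n.+1)%N by rewrite /n; lia.
move: mean_t; rewrite -(big_mkord xpredT (fun j => (j%:R - k%:R) * t j)).
rewrite (big_cat_nat (leq0n k) kn) /= big_mkord.
rewrite (sum_low (fun j => j%:R - k%:R)) (sum_high (fun j => j%:R - k%:R)).
rewrite -big_split /= => mean0.
rewrite -[leLHS]mean0; apply: ler_sum => i _; rewrite natrD /v.
case: ltnP => ik; last by lra.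
have -> : (k.-1 - i)%:R = k%:R - 1 - i%:R :> R.
  by rewrite natrB -?subn1 ?natrB //; lia.
have := t_ge0 (k.-1 - i); lra.
Qed.

(** From i to i + 1 the quotient u / v is multiplied by k^2 ((m + 1)^2 - (i + 1)^2) / (m^2 (k^2 - (i
    + 1)^2)); the identity is cross-multiplied. *)
Let ratio i : (i.+1 < k)%N ->
  u i.+1 * v i * (m%:R ^+ 2 * (k%:R ^+ 2 - i.+1%:R ^+ 2))
  = u i * v i.+1 * (k%:R ^+ 2 * ((m%:R + 1) ^+ 2 - i.+1%:R ^+ 2)).
Proof.
move=> ik.
have ik' := ltnW ik.
have u_rec : u i.+1 * (k%:R + i.+1%:R) * m%:R = u i * (m%:R + 1 - i.+1%:R) * k%:R.
  rewrite /u -natrD addnS t_rec /n !natrD -(addn1 i) natrD; ring.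
have v_rec : v i * (k%:R - i.+1%:R) * m%:R = v i.+1 * (m%:R + 1 + i.+1%:R) * k%:R.
  rewrite /v ik ik'; have -> : (k.-1 - i = (k.-1 - i.+1).+1)%N by lia.
  have -> : k%:R - i.+1%:R = (k.-1 - i.+1).+1%:R :> R.
    by rewrite -natrB //; congr (_%:R); lia.
  rewrite t_rec natrB; last by lia.
  by rewrite /n natrD -subn1 natrB // -(addn1 i) natrD; ring.
transitivity ((u i.+1 * (k%:R + i.+1%:R) * m%:R) * (v i * (k%:R - i.+1%:R) * m%:R)).
  by ring.
by rewrite u_rec v_rec; ring.
Qed.

(** After clearing denominators: the factor of [ratio] leading into index i is below 1. Since this
    persists for larger i, the quotient u / v first does not decrease and then decreases. *)
Let late i := (2 * m%:R + 1) * k%:R ^+ 2 < i%:R ^+ 2 * (k%:R ^+ 2 - m%:R ^+ 2) :> R.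

Let v_gt0 i : (i < k)%N -> 0 < v i.
Proof. by move=> ik; rewrite /v ik t_gt0 // /n; lia. Qed.

Let v_ge0 i : 0 <= v i.
Proof. by rewrite /v; case: ifP. Qed.

Let late_le i j : (i <= j)%N -> late i -> late j.
Proof.
rewrite /late => ij hi.
have ij2 : i%:R ^+ 2 <= j%:R ^+ 2 :> R by rewrite -!natrX ler_nat leq_sqr.
apply: (lt_le_trans hi); rewrite ler_wpM2r //.
have : 0 <= (2 * m%:R + 1) * k%:R ^+ 2 :> R by rewrite mulr_ge0 ?exprn_ge0 ?addr_ge0 ?mulr_ge0.
have : 0 <= i%:R ^+ 2 :> R by rewrite exprn_ge0.
by move: hi; nra.
Qed.

Let weight_gt0 i : (i.+1 < k)%N ->
  0 < v i * (m%:R ^+ 2 * (k%:R ^+ 2 - i.+1%:R ^+ 2)).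
Proof.
move=> ik; rewrite mulr_gt0 ?v_gt0 ?(ltnW ik) //.
by rewrite mulr_gt0 ?exprn_gt0 ?ltr0n // subr_gt0 -!natrX ltr_nat ltn_sqr.
Qed.

(** Induction from u(0) / v(0) = (m + 1) / m along the indices at which the quotient does not
    decrease. *)
Let early_ge i : (i < k)%N -> ~~ late i -> v i <= u i.
Proof.
elim: i => [|i IH] ik late_i.
  have rec0 : u 0 * k%:R * m%:R = v 0 * (m%:R + 1) * k%:R.
    have := t_rec k.-1; rewrite prednK // /u /v ik addn0 subn0 => ->.
    by rewrite /n natrD -subn1 natrB //; ring.
  have k0 : 0 < k%:R :> R by rewrite ltr0n.
  have m0 : 0 < m%:R :> R by rewrite ltr0n.
  have rec1 : u 0 * m%:R = v 0 * (m%:R + 1) by apply: (mulIf (lt0r_neq0 k0)); rewrite -rec0; ring.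
  have v0 := v_ge0 0; rewrite -(ler_pM2r m0) rec1; nra.
have vu : v i <= u i.
  by apply: IH; [exact: ltnW | apply: contraNN late_i; exact: late_le].
rewrite -(ler_pM2r (weight_gt0 ik)) mulrA [leRHS]mulrA (ratio ik).
apply: (@le_trans _ _ (u i * v i.+1 * (m%:R ^+ 2 * (k%:R ^+ 2 - i.+1%:R ^+ 2)))).
  rewrite [v i.+1 * _]mulrC ler_wpM2r ?ler_wpM2r ?v_ge0 //.
  by rewrite mulr_ge0 ?exprn_ge0 // subr_ge0 -!natrX ler_nat leq_sqr ltnW.
apply: ler_wpM2l; first exact: mulr_ge0 (u_ge0 _) (v_ge0 _).
by move: late_i; rewrite /late -leNgt; lra.
Qed.

Let late_step i : (i.+1 < k)%N -> late i.+1 -> u i <= v i -> u i.+1 <= v i.+1.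
Proof.
move=> ik late_i uv.
rewrite -(ler_pM2r (weight_gt0 ik)) mulrA [leRHS]mulrA (ratio ik).
apply: (@le_trans _ _ (u i * v i.+1 * (m%:R ^+ 2 * (k%:R ^+ 2 - i.+1%:R ^+ 2)))).
  apply: ler_wpM2l; first exact: mulr_ge0 (u_ge0 _) (v_ge0 _).
  by move: late_i; rewrite /late; lra.
rewrite [v i.+1 * _]mulrC ler_wpM2r ?ler_wpM2r ?v_ge0 //.
by rewrite mulr_ge0 ?exprn_ge0 // subr_ge0 -!natrX ler_nat leq_sqr ltnW.
Qed.

Let crossing i j : (i <= j)%N -> u i - v i < 0 -> u j - v j <= 0.
Proof.
rewrite subr_lt0 subr_le0 => + uv.
have ik : (i < k)%N.
  by rewrite ltnNge; apply: contraL uv => ki; rewrite -leNgt /v ltnNge ki /= t_ge0.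
have late_i : late i by apply: contraLR uv => /(early_ge ik); rewrite -leNgt.
(* From index k on, [v] is only padding, so [u] has to be over by then: it vanishes beyond m, and
   lateness forces m < k. *)
have mk : (m < k)%N.
  have : 0 < i%:R ^+ 2 * (k%:R ^+ 2 - m%:R ^+ 2) :> R.
    by apply: le_lt_trans late_i; rewrite mulr_ge0 ?exprn_ge0 ?addr_ge0 ?mulr_ge0.
  rewrite ltnNge; apply: contraL => km.
  by rewrite -leNgt mulr_ge0_le0 ?exprn_ge0 // subr_le0 -!natrX ler_nat leq_sqr.
elim: j => [|j IH]; first by rewrite leqn0 => /eqP i0; rewrite -i0; exact: ltW.
rewrite leq_eqVlt => /orP[/eqP <-|ij]; first exact: ltW.
have [jk|kj] := ltnP j.+1 k.
  by apply: late_step => //; [apply: late_le late_i; exact: ltnW | exact: IH].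
by rewrite /u t_eq0 ?v_ge0 // /n; lia.
Qed.

Lemma binomial_low_le_high :
  \sum_(j < k) t j <= \sum_(k <= j < n.+1) t j.
Proof.
have -> : \sum_(j < k) t j = \sum_(i < n.+1) v i.
  rewrite (eq_bigr (fun j : 'I_k => 1 * t j)) => [|j _]; last by rewrite mul1r.
  by rewrite (sum_low (fun=> 1)); apply: eq_bigr => i _; rewrite mul1r.
have -> : \sum_(k <= j < n.+1) t j = \sum_(i < n.+1) u i.
  rewrite (eq_bigr (fun j => 1 * t j)) => [|j _]; last by rewrite mul1r.
  by rewrite (sum_high (fun=> 1)); apply: eq_bigr => i _; rewrite mul1r.
rewrite -subr_ge0 -sumrB.
apply: (@sum_ge0_single_crossing R n.+1 (fun i => u i - v i)) => //; rewrite subr_ge0.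
apply: early_ge => //; rewrite /late -leNgt expr0n mul0r.
by rewrite mulr_ge0 ?exprn_ge0 ?addr_ge0 ?mulr_ge0.
Qed.

End IntegerMeanBinomial.

(** When P is a probability generating function, this is the probability of a value below k.
    Independent sums then become products of polynomials. *)
Definition low_mass (R : nzRingType) (k : nat) (P : {poly R}) : R :=
  \sum_(j < k) P`_j.

Definition bernoulli_pgf (R : nzRingType) (q : R) : {poly R} :=
  (1 - q)%:P + q *: 'X.

Lemma bernoulli_pgf0 (R : nzRingType) : bernoulli_pgf 0 = 1 :> {poly R}.
Proof. by rewrite /bernoulli_pgf subr0 scale0r addr0. Qed.

Lemma bernoulli_pgf1 (R : nzRingType) : bernoulli_pgf 1 = 'X :> {poly R}.
Proof. by rewrite /bernoulli_pgf subrr add0r scale1r. Qed.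

Lemma low_massD (R : nzRingType) (k : nat) (P Q : {poly R}) :
  low_mass k (P + Q) = low_mass k P + low_mass k Q.
Proof. by rewrite -big_split; apply: eq_bigr => j _; rewrite coefD. Qed.

Lemma low_massZ (R : nzRingType) (k : nat) (a : R) (P : {poly R}) :
  low_mass k (a *: P) = a * low_mass k P.
Proof. by rewrite mulr_sumr; apply: eq_bigr => j _; rewrite coefZ. Qed.

Lemma low_massXM (R : nzRingType) (k : nat) (P : {poly R}) :
  low_mass k.+1 ('X * P) = low_mass k P.
Proof.
rewrite /low_mass big_ord_recl coefXM eqxx add0r.
by apply: eq_bigr => j _; rewrite coefXM.
Qed.

(** Each factor is 1 + q (X - 1), so only the sum and the product of the two parameters enter. *)
Lemma low_mass_bernoulli2 (R : comNzRingType) (k : nat) (q1 q2 : R) (P : {poly R}) :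
  low_mass k (bernoulli_pgf q1 * (bernoulli_pgf q2 * P))
  = low_mass k P + (q1 + q2) * low_mass k (('X - 1) * P)
    + q1 * q2 * low_mass k (('X - 1) ^+ 2 * P).
Proof.
rewrite -!low_massZ -!low_massD; congr low_mass.
rewrite /bernoulli_pgf -!mul_polyC !rmorphB /= !rmorphM /= rmorphD /= rmorph1; ring.
Qed.

Lemma low_mass_binomial (R : realFieldType) (n k : nat) (a : R) :
  0 < a < 1 -> a * n%:R = k%:R ->
  low_mass k (bernoulli_pgf a ^+ n) <= 2^-1.
Proof.
move=> /andP[a0 a1] an_k; have [k0|k_gt0] := posnP k.
  by rewrite k0 /low_mass big_ord0 invr_ge0.
have n_gt0 : (0 < n)%N.
  by rewrite lt0n; apply: contraTneq k_gt0 => n0; rewrite -leqNgt -(ler_nat R) -an_k n0 mulr0.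
have nn0 : 0 < n%:R :> R by rewrite ltr0n.
have kn : (k < n)%N by rewrite -(ltr_nat R) -an_k gtr_pMl.
pose m := (n - k)%N.
have m_gt0 : (0 < m)%N by rewrite subn_gt0.
have nE : n = (k + m)%N by rewrite /m; lia.
clearbody m; subst n.
pose n := (k + m)%N; rewrite -/n in an_k n_gt0 nn0 kn *.
have a_k : a = k%:R / n%:R by rewrite -an_k mulfK // gt_eqF.
have a_m : 1 - a = m%:R / n%:R.
  by apply: (mulIf (lt0r_neq0 nn0)); rewrite divfK ?gt_eqF // mulrBl an_k mul1r natrD; ring.
pose t j : R := 'C(n, j)%:R * (k%:R ^+ j * m%:R ^+ (n - j)).
have coef_t j : n%:R ^+ n * (bernoulli_pgf a ^+ n)`_j = t j.
  have -> : bernoulli_pgf a ^+ n = \poly_(i < n.+1) ('C(n, i)%:R * (a ^+ i * (1 - a) ^+ (n - i))).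
    rewrite /bernoulli_pgf exprDn poly_def; apply: eq_bigr => i _.
    rewrite exprZn -rmorphXn /= mul_polyC scalerA -scaler_nat scalerA.
    by congr (_ *: _); ring.
  rewrite coef_poly; case: ltnP => jn; last by rewrite mulr0 /t bin_small ?mul0r.
  have -> : n%:R ^+ n = n%:R ^+ (n - j) * n%:R ^+ j :> R by rewrite -exprD subnK.
  rewrite /t a_m a_k !expr_div_n.
  have := expf_neq0 j (lt0r_neq0 nn0); have := expf_neq0 (n - j) (lt0r_neq0 nn0).
  move: (n%:R ^+ (n - j)) (n%:R ^+ j) (k%:R ^+ j) (m%:R ^+ (n - j)) => x y z w x0 y0.
  by field; rewrite x0 y0.
have nn_gt0 : 0 < n%:R ^+ n :> R by rewrite exprn_gt0.
rewrite -(ler_pM2l nn_gt0) mulr_sumr.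
rewrite (eq_bigr (fun j : 'I_k => t j)) => [|j _]; last exact: coef_t.
have := binomial_low_le_high R k_gt0 m_gt0; rewrite -/n -/t.
(* Together with [binomial_low_le_high], this makes the low part at most half of n^n. *)
have total : \sum_(j < k) t j + \sum_(k <= j < n.+1) t j = n%:R ^+ n.
  rewrite -(big_mkord xpredT t) -big_cat_nat //=; last by rewrite leqW // ltnW.
  have -> : n%:R = m%:R + k%:R :> R by rewrite natrD addrC.
  rewrite big_mkord exprDn; apply: eq_bigr => j _.
  by rewrite /t -[RHS]mulr_natl; congr (_ * _); rewrite mulrC.
by move: total; lra.
Qed.

(* Hoeffding's smoothing: low_mass is affine in the product of two of the
   parameters when their sum is fixed, so it can be increased either by moving
   one of them to the average or by moving one of them to 0 or 1. *)
Lemma low_mass_poisson_binomial (R : realFieldType) (s : seq R) (k : nat) :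
    all (fun q => 0 <= q <= 1) s -> \sum_(q <- s) q = k%:R ->
  low_mass k (\prod_(q <- s) bernoulli_pgf q) <= 2^-1.
Proof.
have [n] := ubnP (size s); elim: n s k => // n IHn s k; rewrite ltnS => size_s.
(* A parameter 0 contributes nothing and a parameter 1 shifts the sum by one, lowering k; either way
   the list gets shorter. *)
have extreme (q : R) (s' : seq R) : (size s' < n)%N -> (q == 0) || (q == 1) ->
    all (fun q => 0 <= q <= 1) s' -> q + \sum_(x <- s') x = k%:R ->
  low_mass k (bernoulli_pgf q * \prod_(x <- s') bernoulli_pgf x) <= 2^-1.
  move=> size_s' /orP[/eqP->|/eqP->] s'01.
    by rewrite add0r => sum_s'; rewrite bernoulli_pgf0 mul1r; exact: IHn.
  have s'_ge0 : 0 <= \sum_(q <- s') q.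
    by rewrite big_seq; apply: sumr_ge0 => x /(allP s'01)/andP[].
  rewrite bernoulli_pgf1.
  case: k => [|k sum_s']; first by lra.
  by rewrite low_massXM; apply: IHn => //; move: sum_s'; rewrite -addn1 natrD; lra.
pose a : R := k%:R / (size s)%:R.
have : a * (size s)%:R = k%:R \/ s = [::].
  rewrite /a; case: (s) => [|x s']; [by right | left]; by rewrite divfK // pnatr_eq0.
clearbody a => - [a_avg|->]; last first.
  rewrite !big_nil => _ /eqP; rewrite eq_sym pnatr_eq0 => /eqP ->.
  by rewrite /low_mass big_ord0 invr_ge0.
(* Inner induction on the number of parameters different from the average [a]; moves that keep the
   length and the sum keep [a]. *)
have [c] := ubnP (count (predC1 a) s).
elim: c s size_s a_avg => // c IHc s size_s a_avg; rewrite ltnS => count_s s01 sum_s.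
have rem_prod (F : R -> {poly R}) q : q \in s ->
    \prod_(x <- s) F x = F q * \prod_(x <- rem q s) F x.
  by move=> qs; rewrite (perm_big _ (perm_to_rem qs)) big_cons.
have rem_sum q : q \in s -> q + \sum_(x <- rem q s) x = k%:R.
  by move=> qs; rewrite -sum_s (perm_big _ (perm_to_rem qs)) big_cons.
have rem01 q : q \in s -> all (fun x => 0 <= x <= 1) (rem q s).
  by move=> qs; apply/allP => x /mem_rem /(allP s01).
have rem_size q : q \in s -> (size (rem q s)).+1 = size s.
  by move=> qs; rewrite size_rem // prednK //; case: (s) qs.
have [/hasP [q qs q01]|/hasPn interior] := boolP (has (fun q => (q == 0) || (q == 1)) s).
  rewrite (rem_prod _ _ qs); apply: extreme => //; [|exact: rem01|exact: rem_sum].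
  by rewrite rem_size.
have [/all_pred1P s_nseq|] := boolP (all (pred1 a) s).
  have [s_nil|s_gt0] := posnP (size s).
    move: sum_s; rewrite (size0nil s_nil) !big_nil => /eqP.
    rewrite eq_sym pnatr_eq0 => /eqP ->.
    by rewrite /low_mass big_ord0 invr_ge0.
  have a_in : a \in s by rewrite s_nseq mem_nseq s_gt0 eqxx.
  rewrite s_nseq big_nseq -Monoid.iteropE -/(GRing.exp _ _).
  apply: low_mass_binomial => //.
  have := interior a a_in; have := allP s01 a a_in.
  by rewrite negb_or !lt_neqAle [0 == a]eq_sym => /andP[-> ->] /andP[-> ->].
rewrite -has_predC => /hasP [q0 q0s /= q0a].
have sum_dev : \sum_(q <- s) (q - a) = 0.
  by rewrite sumrB big_const_seq count_predT iter_addr_0 -mulr_natr a_avg sum_s subrr.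
(* The deviations from [a] sum to 0 and one is nonzero, so some parameter lies below [a] and another
   above it. *)
have [q1 q1s q1a] : exists2 q1, q1 \in s & q1 < a.
  apply/hasP; apply: contraNT q0a => /hasPn above.
  have ge_a q : q \in s -> 0 <= q - a by move=> /above; rewrite -leNgt subr_ge0.
  move/eqP: sum_dev; rewrite big_seq psumr_eq0 // => /allP /(_ _ q0s).
  by rewrite q0s subr_eq0.
have [q2 q2s q2a] : exists2 q2, q2 \in rem q1 s & a < q2.
  apply/hasP; rewrite -[has _ _]negbK; apply/negP => /hasPn below.
  have : \sum_(q <- rem q1 s) (q - a) <= 0.
    by rewrite big_seq; apply: sumr_le0 => q /below; rewrite -leNgt subr_le0.
  move: sum_dev; rewrite (perm_big _ (perm_to_rem q1s)) big_cons /=.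
  by move: (\sum_(q <- _) _) => S; move: q1a; lra.
pose s' := rem q2 (rem q1 s).
have perm_s : perm_eq s [:: q1, q2 & s'].
  apply: perm_trans (perm_to_rem q1s) _; rewrite perm_cons; exact: perm_to_rem.
have sE : size s = (size s').+2 by rewrite (perm_size perm_s).
have s'01 : all (fun q => 0 <= q <= 1) s'.
  by apply/allP => x /mem_rem /(allP (rem01 _ q1s)).
have sum_s' : q1 + q2 + \sum_(q <- s') q = k%:R.
  by rewrite -sum_s (perm_big _ perm_s) !big_cons /= addrA.
have count_s' : count (predC1 a) s = (count (predC1 a) s').+2.
  by rewrite (permP perm_s) /= (lt_eqF q1a) (gt_eqF q2a).
have /andP[q1_ge0 q1_le1] := allP s01 _ q1s.
have /andP[q2_ge0 q2_le1] := allP s01 _ (mem_rem q2s).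
rewrite (perm_big _ perm_s) !big_cons /= low_mass_bernoulli2.
set P := \prod_(q <- s') _.
(* The sign of the coefficient of [q1 * q2] decides the move. If it is nonnegative, the pair a, q1 +
   q2 - a has the product larger by (a - q1) (q2 - a). If it is negative, the smallest product is
   wanted, and it is reached with a parameter 0 or 1. *)
have [C_ge0|C_lt0] := leP 0 (low_mass k (('X - 1) ^+ 2 * P)).
  pose s2 := [:: a, q1 + q2 - a & s'].
  apply: (@le_trans _ _ (low_mass k (\prod_(q <- s2) bernoulli_pgf q))).
    rewrite !big_cons low_mass_bernoulli2 -/P addrCA subrr addr0.
    by rewrite lerD2l ler_wpM2r //; nra.
  apply: IHc; rewrite /s2 //=; first by rewrite -sE.
  - by rewrite -sE.
  - rewrite eqxx add0n; apply: leq_ltn_trans (_ : (count (predC1 a) s').+1 < c)%N.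
      by case: (_ == _).
    by rewrite -ltnS -count_s'.
  - by rewrite s'01 andbT; apply/andP; split; lra.
  - by rewrite !big_cons; lra.
have size_s'' : ((size s').+1 < n)%N by rewrite -sE.
have [le1|gt1] := leP (q1 + q2) 1.
  apply: (@le_trans _ _ (low_mass k (bernoulli_pgf 0 * \prod_(q <- q1 + q2 :: s') bernoulli_pgf q))).
    rewrite big_cons low_mass_bernoulli2 -/P add0r mul0r.
    by rewrite lerD2l ler_wnM2r ?mulr_ge0 // ltW.
  apply: extreme; rewrite ?eqxx //=; first by rewrite s'01 andbT; lra.
  by rewrite big_cons add0r.
apply: (@le_trans _ _ (low_mass k (bernoulli_pgf 1 * \prod_(q <- q1 + q2 - 1 :: s') bernoulli_pgf q))).
  rewrite big_cons low_mass_bernoulli2 -/P addrCA subrr addr0 mul1r.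
  by rewrite lerD2l ler_wnM2r ?(ltW C_lt0) //; nra.
apply: extreme; rewrite ?eqxx ?orbT //=; first by rewrite s'01 andbT; lra.
by rewrite big_cons; lra.
Qed.

(** * Finite product probability spaces *)

Section Mean.
Variables (R : realType) (T : finType).
Implicit Types (Y Z : T -> R) (E : {set T}).

Lemma eq_mean Y Z : Y =1 Z -> mean Y = mean Z.
Proof. by move=> eqYZ; rewrite /mean (eq_bigr Z). Qed.

Lemma meanD Y Z : mean (fun w => Y w + Z w) = mean Y + mean Z.
Proof. by rewrite /mean big_split mulrDl. Qed.

Lemma meanZ (a : R) Y : mean (fun w => a * Y w) = a * mean Y.
Proof. by rewrite /mean -mulr_sumr mulrA. Qed.

Lemma mean_sum (I : finType) (F : I -> T -> R) :
  mean (fun w => \sum_i F i w) = \sum_i mean (F i).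
Proof. by rewrite /mean exchange_big /= mulr_suml. Qed.

Lemma le_mean Y Z : (forall w, Y w <= Z w) -> mean Y <= mean Z.
Proof. by move=> leYZ; rewrite ler_wpM2r ?invr_ge0 // ler_sum. Qed.

Lemma mean_ge0 Y : (forall w, 0 <= Y w) -> 0 <= mean Y.
Proof. by move=> Y_ge0; rewrite divr_ge0 // sumr_ge0. Qed.

Lemma mean_cst (a : R) : (0 < #|T|)%N -> mean (fun _ : T => a) = a.
Proof.
move=> T_gt0; rewrite /mean sumr_const -[a *+ _]mulr_natr mulfK //.
by rewrite pnatr_eq0 -lt0n.
Qed.

Lemma probE E : prob R E = mean (fun w => (w \in E)%:R).
Proof.
rewrite /prob /mean -sum1_card natr_sum big_mkcond; congr (_ / _).
by apply: eq_bigr => w _; case: ifP.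
Qed.

Lemma prob_le1 E : prob R E <= 1.
Proof.
rewrite /prob; have [->|T_gt0] := posnP #|T|; first by rewrite invr0 mulr0.
by rewrite ler_pdivrMr ?ltr0n // mul1r ler_nat max_card.
Qed.

Lemma prob_ge0 E : 0 <= prob R E.
Proof. by rewrite divr_ge0. Qed.

Lemma probS (E F : {set T}) : E \subset F -> prob R E <= prob R F.
Proof. by move=> EF; rewrite ler_wpM2r ?invr_ge0 // ler_nat subset_leq_card. Qed.

Lemma probU (E F : {set T}) : prob R (E :|: F) <= prob R E + prob R F.
Proof.
by rewrite -mulrDl ler_wpM2r ?invr_ge0 // -natrD ler_nat cardsU leq_subr.
Qed.

Lemma probC E : (0 < #|T|)%N -> prob R (~: E) = 1 - prob R E.
Proof.
move=> T_gt0; rewrite /prob -(cardsC E) natrD.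
have : #|E|%:R + #|~: E|%:R != 0 :> R by rewrite -natrD cardsC pnatr_eq0 -lt0n.
by move=> ?; field.
Qed.

Lemma markov_prob (E : {set T}) Y :
  (forall w, 0 <= Y w) -> (forall w, w \in E -> 1 <= Y w) -> prob R E <= mean Y.
Proof.
move=> Y_ge0 Y_ge1; rewrite probE; apply: le_mean => w.
by case: (boolP (w \in E)) => [/Y_ge1|].
Qed.

End Mean.

Section Product.
Variables (R : realType) (I V : finType).
Hypothesis V_gt0 : (0 < #|V|)%N.

Lemma mean_ffun_prod (G : I -> V -> R) :
  mean (fun u : {ffun I -> V} => \prod_i G i (u i)) = \prod_i mean (G i).
Proof.
rewrite /mean -bigA_distr_bigA /= card_ffun natrX big_split /=.
by rewrite prodr_const exprVn.
Qed.

Lemma mean_ffun_proj (i : I) (G : V -> R) :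
  mean (fun u : {ffun I -> V} => G (u i)) = mean G.
Proof.
rewrite (eq_mean (Z := fun u : {ffun I -> V} =>
    \prod_j (if j == i then G (u j) else 1))) => [|u].
  rewrite (mean_ffun_prod (fun j v => if j == i then G v else 1)).
  rewrite (bigD1 i) //= eqxx big1 ?mulr1 // => j /negPf ->.
  by rewrite mean_cst.
by rewrite (bigD1 i) //= eqxx big1 ?mulr1 // => j /negPf ->.
Qed.

(** * Bernstein's inequality for the lower tail *)

Section Bernstein.
Variables (Z : I -> V -> R) (W L : R).
Hypotheses (Z_ge0 : forall i v, 0 <= Z i v) (Z_le3 : forall i v, Z i v <= 3).
Hypotheses (W_gt0 : 0 < W) (L_gt0 : 0 < L).
Hypothesis varZ : \sum_i (mean (fun v => Z i v ^+ 2) - mean (Z i) ^+ 2) <= W.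

(** The quadratic term of [expR_pade] has denominator 2 (1 - x / 3), and x / 3 <= l. *)
Let expR_bennett (l x : R) :
  l < 1 -> x <= 3 * l -> expR x <= 1 + x + x ^+ 2 / (2 * (1 - l)).
Proof.
move=> l1 xl; have x3 : 0 < 6 - 2 * x by lra.
have l1' : 0 < 1 - l by lra.
rewrite -(ler_pM2r x3); apply: le_trans (expR_pade x) _.
have -> : (1 + x + x ^+ 2 / (2 * (1 - l))) * (6 - 2 * x)
  = 6 + 4 * x + x ^+ 2 + 3 * x ^+ 2 * ((6 - 2 * x) / (6 * (1 - l)) - 1).
  by field; lra.
rewrite lerDl; apply: mulr_ge0; first by rewrite mulr_ge0 ?sqr_ge0.
by rewrite subr_ge0 ler_pdivlMr ?mulr_gt0 // mul1r; lra.
Qed.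

(** The exponent is at most 3 l because [Z] is nonnegative with mean at most 3. Averaging
    [expR_bennett] kills the linear term and leaves 1 plus a multiple of the variance. *)
Let mgf (l : R) (i : I) : 0 <= l < 1 ->
  mean (fun v => expR (l * (mean (Z i) - Z i v)))
  <= expR (l ^+ 2 / (2 * (1 - l)) * (mean (fun v => Z i v ^+ 2) - mean (Z i) ^+ 2)).
Proof.
move=> /andP[l0 l1]; set e := mean (Z i).
have meanZ_e : mean (fun v => Z i v) = e by [].
have e_le3 : e <= 3 by rewrite -(mean_cst 3 V_gt0); exact: le_mean.
clearbody e; have l1' : 0 < 1 - l by lra.
apply: (@le_trans _ _ (mean (fun v =>
    1 + l * e + l ^+ 2 / (2 * (1 - l)) * e ^+ 2
    + (- (l + l ^+ 2 / (1 - l) * e)) * Z i v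
    + l ^+ 2 / (2 * (1 - l)) * Z i v ^+ 2))).
  apply: le_mean => v.
  have : l * (e - Z i v) <= 3 * l.
    by rewrite mulrC ler_wpM2r //; have := Z_ge0 i v; lra.
  move=> /(expR_bennett l1) /le_trans; apply.
  rewrite le_eqVlt; apply/orP; left; apply/eqP; field; lra.
rewrite !meanD !meanZ !mean_cst // meanZ_e.
apply: le_trans (expR_ge1Dx _).
rewrite le_eqVlt; apply/orP; left; apply/eqP; field; lra.
Qed.

Lemma bernstein_lower_tail :
  prob R [set u : {ffun I -> V} |
    \sum_i Z i (u i) <= \sum_i mean (Z i) - Num.sqrt (2 * L * (W + L / 2)) - L]
  <= expR (- L).
Proof.
(* The deviation t is the positive root of t^2 = 2 L (W + t). With l = t / (W + t) the Chernoff
   exponent is - t^2 / (2 (W + t)), which is - L. *)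
set q := Num.sqrt _; pose t := q + L; pose l := t / (W + t).
have q0 : 0 <= q by exact: sqrtr_ge0.
have q2 : q ^+ 2 = 2 * L * W + L ^+ 2.
  rewrite sqr_sqrtr; last by rewrite !mulr_ge0 ?addr_ge0 ?divr_ge0 // ltW.
  by field.
have tE : t = q + L by [].
clearbody t q.
have t0 : 0 < t by move: L_gt0; lra.
have Wt0 : 0 < W + t by move: W_gt0; lra.
have lE : l = t / (W + t) by [].
have l1E : 1 - l = W / (W + t) by rewrite /l; field; lra.
have /andP[l0 l1] : 0 <= l < 1.
  rewrite lE divr_ge0 ?(ltW t0) ?(ltW Wt0) //= ltr_pdivrMr // mul1r.
  by move: W_gt0; lra.
clearbody l.
apply: (@le_trans _ _ (mean (fun u : {ffun I -> V} =>
    expR (- (l * t)) * \prod_i expR (l * (mean (Z i) - Z i (u i)))))).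
  apply: markov_prob => u.
    by rewrite mulr_ge0 ?expR_ge0 // prodr_ge0 // => i _; exact: expR_ge0.
  rewrite inE => low; rewrite -expR_sum -expRD -expR0 ler_expR -mulr_sumr sumrB.
  rewrite -mulrN -mulrDr mulr_ge0 //; lra.
rewrite meanZ (mean_ffun_prod (fun i v => expR (l * (mean (Z i) - Z i v)))).
apply: (@le_trans _ _ (expR (- (l * t)) * expR (l ^+ 2 / (2 * (1 - l)) * W))).
  rewrite ler_wpM2l ?expR_ge0 //.
  apply: (@le_trans _ _ (\prod_i expR (l ^+ 2 / (2 * (1 - l))
      * (mean (fun v => Z i v ^+ 2) - mean (Z i) ^+ 2)))).
    apply: ler_prod => i _; rewrite mgf ?l0 // andbT.
    by apply: mean_ge0 => v; exact: expR_ge0.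
  rewrite -expR_sum ler_expR -mulr_sumr ler_wpM2l //.
  by rewrite divr_ge0 ?sqr_ge0 // mulr_ge0 //; lra.
rewrite -expRD ler_expR l1E lE le_eqVlt; apply/orP; left; apply/eqP.
have t2 : t ^+ 2 = 2 * L * (W + t) by rewrite tE sqrrD q2; ring.
transitivity (- (t ^+ 2 / (2 * (W + t)))); first by field; move: W_gt0; lra.
by rewrite t2; field; move: W_gt0; lra.
Qed.

End Bernstein.

(** * From exact integer means to means of at least k *)

Lemma coefM_ge0 (P Q : {poly R}) :
  (forall j, 0 <= P`_j) -> (forall j, 0 <= Q`_j) -> forall j, 0 <= (P * Q)`_j.
Proof. by move=> P0 Q0 j; rewrite coefM sumr_ge0 // => l _; exact: mulr_ge0. Qed.

(** One parameter is lowered at a time, [P] collecting the factors already treated. The dependence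
    on a parameter is affine, and its slope, low_mass of Q (X - 1), is minus the coefficient of Q at
    k - 1. *)
Lemma low_mass_le_prod (r : seq I) (q q' : I -> R) (k : nat) (P : {poly R}) :
    (forall i, 0 <= q' i <= q i) -> (forall i, q i <= 1) ->
    (forall j, 0 <= P`_j) ->
  low_mass k (P * \prod_(i <- r) bernoulli_pgf (q i))
  <= low_mass k (P * \prod_(i <- r) bernoulli_pgf (q' i)).
Proof.
move=> q'q q1.
have nneg (x : R) : 0 <= x <= 1 -> forall j, 0 <= (bernoulli_pgf x)`_j.
  move=> /andP[x0 x1] j; rewrite /bernoulli_pgf coefD coefC coefZ coefX.
  by rewrite addr_ge0 //; case: eqP => _; rewrite ?mulr1 ?mulr0 ?subr_ge0.
have nneg_q i : forall j, 0 <= (bernoulli_pgf (q i))`_j.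
  by apply: nneg; rewrite q1 andbT; case/andP: (q'q i); exact: le_trans.
have nneg_q' i : forall j, 0 <= (bernoulli_pgf (q' i))`_j.
  by apply: nneg; case/andP: (q'q i) => -> /le_trans ->.
elim: r P => [|i r IHr] P P0; first by rewrite !big_nil.
rewrite !big_cons !mulrA; apply: le_trans (IHr _ _); last exact: coefM_ge0.
rewrite -![P * _ * _]mulrA ![bernoulli_pgf _ * _]mulrC !mulrA.
set Q := P * _.
have Q0 : forall j, 0 <= Q`_j.
  apply: coefM_ge0 => //; elim/big_ind: _ => [j|? ?|i0 _]; [|exact: coefM_ge0|by []].
  by rewrite coefC; case: eqP.
have expand x : low_mass k (Q * bernoulli_pgf x)
    = low_mass k Q + x * low_mass k (Q * ('X - 1)).
  rewrite -low_massZ -low_massD; congr low_mass.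
  by rewrite /bernoulli_pgf -mul_polyC rmorphB /= rmorph1 -mul_polyC; ring.
have drop_le0 : low_mass k (Q * ('X - 1)) <= 0.
  rewrite mulrBr mulr1 low_massD -[- Q]scaleN1r low_massZ mulN1r [Q * 'X]mulrC.
  case: (k) => [|k']; first by rewrite /low_mass !big_ord0 subrr.
  rewrite low_massXM subr_le0 [leRHS]/low_mass big_ord_recr /= lerDl.
  exact: Q0.
by rewrite !expand lerD2l ler_wnM2r //; case/andP: (q'q i).
Qed.

(** The means are scaled down by k / Q so as to sum to exactly k, where [low_mass_poisson_binomial]
    applies; restoring them only removes mass below k. *)
Lemma poisson_binomial_median (D : I -> V -> bool) (k : nat) :
    k%:R <= \sum_i mean (fun v => (D i v)%:R : R) ->
  2^-1 <= prob R [set u : {ffun I -> V} | (k <= #|[set i | D i (u i)]|)%N].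
Proof.
set q := fun i => mean (fun v => (D i v)%:R : R); move=> k_le.
have VR_gt0 : 0 < #|V|%:R :> R by rewrite ltr0n.
have q01 i : 0 <= q i <= 1.
  rewrite mean_ge0 => [|v]; last by rewrite ler0n.
  by rewrite -(mean_cst 1 V_gt0) le_mean // => v; rewrite lern1 leq_b1.
have ffun_gt0 : (0 < #|{ffun I -> V}|)%N by rewrite card_ffun expn_gt0 V_gt0.
pose S (u : {ffun I -> V}) := #|[set i | D i (u i)]|.
(* Each factor is the average over v of X to the power [D i v], so the expanded product is the
   average over u of X to the power [S u]. *)
have low_massS : low_mass k (\prod_i bernoulli_pgf (q i))
    = prob R [set u : {ffun I -> V} | (S u < k)%N].
  have bernE i : bernoulli_pgf (q i) = (#|V|%:R^-1 : R) *: \sum_(v : V) 'X^(D i v) :> {poly R}.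
    have XbE (b : bool) : 'X^b = (1 : R) *: 1 + (b%:R : R) *: ('X - 1) :> {poly R}.
      by case: b; rewrite ?scale0r ?scale1r ?addr0 ?expr0 // addrC subrK.
    under eq_bigr do rewrite XbE.
    rewrite big_split /= -!scaler_suml sumr_const scalerDr !scalerA.
    rewrite (_ : #|xpredT : pred V| = #|V|); last exact: eq_card.
    rewrite mulVf ?gt_eqF // scale1r mulrC -[X in X *: _]/(q i) /bernoulli_pgf.
    by rewrite scalerBr polyCB alg_polyC polyC1; ring.
  rewrite (eq_bigr _ (fun i _ => bernE i)) scaler_prod prodr_const.
  have -> : \prod_i \sum_(v : V) 'X^(D i v) = \sum_(u : {ffun I -> V}) 'X^(S u) :> {poly R}.
    rewrite bigA_distr_bigA /=; apply: eq_bigr => u _.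
    rewrite -(big_morph _ (exprD 'X) (expr0 'X)); congr ('X^_).
    by rewrite /S -sum1dep_card [RHS]big_mkcond; apply: eq_bigr => i _; case: (D i _).
  rewrite low_massZ.
  rewrite probE /mean card_ffun natrX exprVn mulrC; congr (_ / _).
  rewrite /low_mass; under eq_bigr do rewrite coef_sum.
  rewrite exchange_big /=; apply: eq_bigr => u _.
  rewrite inE.
  under eq_bigr do rewrite coefXn.
  case: ltnP => Sk; last first.
    by rewrite big1 // => j _; rewrite ltn_eqF // (leq_trans (ltn_ord j) Sk).
  rewrite (bigD1 (Ordinal Sk)) //= eqxx big1 ?addr0 // => j.
  by rewrite -val_eqE /= => /negPf ->.
set Q := \sum_i q i in k_le; pose q' i := q i * (k%:R / Q).
have Q_ge0 : 0 <= Q by apply: sumr_ge0 => i _; case/andP: (q01 i).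
have kQ : 0 <= k%:R / Q <= 1.
  rewrite divr_ge0 //=; have [->|Q_neq0] := eqVneq Q 0; first by rewrite invr0 mulr0.
  by rewrite ler_pdivrMr ?mul1r // lt_def Q_neq0.
have q'q i : 0 <= q' i <= q i.
  have /andP[qi0 _] := q01 i; case/andP: kQ => kQ0 kQ1.
  by rewrite mulr_ge0 //= ler_piMr.
have low_le : low_mass k (\prod_i bernoulli_pgf (q i)) <= 2^-1.
  have one_ge0 j : 0 <= (1 : {poly R})`_j by rewrite coefC; case: eqP.
  have := low_mass_le_prod (index_enum I) k q'q (fun i => proj2 (andP (q01 i))) one_ge0.
  rewrite !mul1r => /le_trans; apply.
  rewrite -(big_map q' xpredT (@bernoulli_pgf R)); apply: low_mass_poisson_binomial.
    apply/allP => x /mapP[i _ ->]; case/andP: (q'q i) => -> /le_trans; apply.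
    by case/andP: (q01 i).
  (* If Q = 0 the quotient k / Q is 0 by convention, but then k = 0 as well. *)
  rewrite big_map -mulr_suml -/Q; have [Q0|Q_neq0] := eqVneq Q 0.
    by move: k_le; rewrite Q0 mul0r lern0 => /eqP ->.
  by rewrite mulrC divfK.
have -> : [set u : {ffun I -> V} | (k <= #|[set i | D i (u i)]|)%N]
    = ~: [set u : {ffun I -> V} | (S u < k)%N].
  by apply/setP => u; rewrite !inE -leqNgt.
by rewrite probC // -low_massS; move: low_le; lra.
Qed.

End Product.

(** * Simple tabulation of linearly independent keys *)

Section Averaging.
Variable R : realType.

Lemma mean_inj (T : finType) (g : T -> T) (Y : T -> R) :
  injective g -> mean (fun w => Y (g w)) = mean Y.
Proof. by move=> g_inj; rewrite /mean [in RHS](reindex_inj g_inj). Qed.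

Lemma mean_exchange (S T : finType) (Y : S -> T -> R) :
  mean (fun s => mean (Y s)) = mean (fun t => mean (fun s => Y s t)).
Proof. by rewrite /mean -!mulr_suml exchange_big /= -!mulrA [_^-1 * _]mulrC. Qed.

(** Composing with a uniformly chosen bijection preserves the mean. This exposes fresh randomness
    inside the tables: fix the outcome and average over its translates. *)
Lemma mean_average (S T : finType) (g : S -> T -> T) (Y : T -> R) :
    (0 < #|S|)%N -> (forall s, injective (g s)) ->
  mean Y = mean (fun w => mean (fun s => Y (g s w))).
Proof.
move=> S_gt0 g_inj; rewrite mean_exchange.
rewrite [RHS](eq_mean (Z := fun=> mean Y)) ?mean_cst // => s.
exact: mean_inj.
Qed.

Lemma mean_addl (V : finZmodType) (a : V) (Y : V -> R) :
  mean (fun v => Y (a + v)) = mean Y.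
Proof. exact: mean_inj (addrI a). Qed.

End Averaging.

Lemma bits_gt0 (r : nat) : (0 < #|{: bits r}|)%N.
Proof. by apply/card_gt0P; exists 0. Qed.

Lemma bits_addrr (r : nat) (v : bits r) : v + v = 0.
Proof. by apply/rowP => j; rewrite !mxE addrr_pchar2 // pchar_Fp. Qed.

Definition add_tables (m k r : nat) (T T' : simple_tables m k r) : simple_tables m k r :=
  [ffun j => [ffun a => T j a + T' j a]].

Lemma simple_tab_add (m k r : nat) (T T' : simple_tables m k r) (y : m.-tuple (bits k)) :
  simple_tab (add_tables T T') y = simple_tab T y + simple_tab T' y.
Proof. by rewrite /simple_tab -big_split; apply: eq_bigr => j _; rewrite !ffunE. Qed.

Lemma add_tablesK (m k r : nat) (T' : simple_tables m k r) :
  involutive (fun T => add_tables T T').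
Proof.
by move=> T; apply/ffunP => j; apply/ffunP => a; rewrite !ffunE -addrA bits_addrr addr0.
Qed.

Lemma mem_position_chars (k m : nat) (z : m.-tuple (bits k)) (a : 'I_m * bits k) :
  (a \in position_chars z) = (tnth z a.1 == a.2).
Proof.
apply/imsetP/eqP => [[j _ ->] //|za]; exists a.1 => //.
by rewrite za; case: a {za}.
Qed.

Section LinearIndependence.
Variables (k m r : nat) (I : finType) (U : {set I}) (y : I -> m.-tuple (bits k)).
Hypothesis indep : lin_indep U y.

(* Over F_2 the incidence matrix of the family has independent rows, and B is a
   right inverse of it. *)
Lemma lin_indep_dual : exists B : I -> 'I_m -> bits k -> 'F_2,
  {in U &, forall x x', \sum_(j < m) B x j (tnth (y x') j) = (x == x')%:R}.
Proof.
pose M : 'M['F_2]_(#|U|, #|{: 'I_m * bits k}|) :=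
  \matrix_(i, j) (enum_val j \in position_chars (y (enum_val i)))%:R.
have M_free : row_free M.
  (* A nonzero vector of the left kernel is the indicator of a subfamily in which every position
     character occurs an even number of times. *)
  apply: inj_row_free => v vM0; apply/rowP => i; rewrite [RHS]mxE.
  pose N := [set i | v 0 i != 0].
  pose B := [set enum_val i | i in N].
  have v1 i' : v 0 i' = (i' \in N)%:R.
    by rewrite inE; case: (v 0 i') => [[|[|]]] //= ?; exact: val_inj.
  apply/eqP; apply: contraTT indep => vi; rewrite negbK; apply/existsP; exists B.
  apply/and3P; split.
  - by apply/subsetP => x /imsetP[i' _ ->]; exact: enum_valP.
  - by apply/set0Pn; exists (enum_val i); rewrite imset_f // inE.
  apply/forallP => a; rewrite -dvdn2 (dvdn_pcharf (pchar_Fp (p := 2) isT)).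
  move/rowP: vM0 => /(_ (enum_rank a)); rewrite !mxE => sum0.
  rewrite -[X in _ == X]sum0; apply/eqP.
  have -> : [set x in B | a \in position_chars (y x)]
      = [set enum_val i | i in [set i in N | a \in position_chars (y (enum_val i))]].
    apply/setP => x; rewrite inE; apply/andP/imsetP => [[/imsetP[i' Ni' ->] ai']|[i']].
      by exists i'; rewrite // inE Ni'.
    by rewrite inE => /andP[Ni' ai'] ->; rewrite imset_f.
  rewrite card_imset; last exact: enum_val_inj.
  rewrite -sum1_card natr_sum big_mkcond /=; apply: eq_bigr => i' _.
  rewrite mxE enum_rankK v1 [i' \in [set _ in N | _]]inE.
  by case: (i' \in N); case: (a \in position_chars _); rewrite ?mulr0 ?mulr1.
have /row_freeP [B MB] := M_free.
exists (fun x j b => if x \in U =P true is ReflectT xU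
                     then B (enum_rank (j, b)) (enum_rank_in xU x) else 0).
move=> x x' xU x'U.
case: eqP => // xU'.
transitivity ((M *m B) (enum_rank_in x'U x') (enum_rank_in xU' x)); last first.
  rewrite MB mxE eq_sym; congr (_%:R); congr nat_of_bool.
  rewrite -(inj_eq enum_val_inj) !enum_rankK_in //.
rewrite mxE (reindex (@enum_rank ('I_m * bits k)%type)) /=; last first.
  by exists enum_val => a _; rewrite ?enum_rankK ?enum_valK.
rewrite [RHS](eq_bigr (fun a => if tnth (y x') a.1 == a.2
    then B (enum_rank (a.1, a.2)) (enum_rank_in xU' x) else 0)); last first.
  move=> [j b] _; rewrite mxE enum_rankK enum_rankK_in // mem_position_chars /=.
  by case: eqP => _; rewrite ?mul1r ?mul0r.
rewrite -(pair_bigA _ (fun j b => if tnth (y x') j == b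
    then B (enum_rank (j, b)) (enum_rank_in xU' x) else 0)) /=.
apply: eq_bigr => j _; rewrite -big_mkcond /=.
by rewrite (eq_bigl (pred1 (tnth (y x') j))) ?big_pred1_eq // => b; rewrite /= eq_sym.
Qed.

(** Superpose the dual tables of [lin_indep_dual], each multiplied by its target value. *)
Lemma lin_indep_interpolate (c : I -> bits r) :
  exists T : simple_tables m k r, {in U, forall x, simple_tab T (y x) = c x}.
Proof.
have [B BE] := lin_indep_dual.
exists [ffun j => [ffun b => \sum_(x in U) B x j b *: c x]] => x xU.
rewrite /simple_tab; under eq_bigr do rewrite !ffunE.
rewrite exchange_big /= (bigD1 x) //= -scaler_suml BE // eqxx scale1r.
rewrite big1 ?addr0 // => x' /andP[x'U x'x].
by rewrite -scaler_suml BE // (negPf x'x) scale0r.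
Qed.

(** For fixed T, translate by tables that interpolate a uniform function c: the hash value of each x
    in U is shifted by c(x), and these shifts are independent and uniform. *)
Lemma lin_indep_uniform (R : realType) (G : I -> bits r -> R) :
  mean (fun T : simple_tables m k r => \prod_(x in U) G x (simple_tab T (y x)))
  = \prod_(x in U) mean (G x).
Proof.
have tabP (c : {ffun I -> bits r}) : {T : simple_tables m k r |
    [forall x in U, simple_tab T (y x) == c x]}.
  apply/sigW; have [T TE] := lin_indep_interpolate c; exists T.
  by apply/forall_inP => x /TE ->.
pose g (c : {ffun I -> bits r}) T := add_tables T (sval (tabP c)).
rewrite (@mean_average _ _ _ g); first last.
- by move=> c; exact: inv_inj (@add_tablesK _ _ _ _).
- by rewrite card_ffun expn_gt0 bits_gt0.
rewrite (eq_mean (Z := fun=> \prod_(x in U) mean (G x))); last first.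
  move=> T; rewrite (eq_mean (Z := fun c : {ffun I -> bits r} =>
      \prod_x (if x \in U then G x (simple_tab T (y x) + c x) else 1))) => [|c]; last first.
    rewrite -big_mkcond; apply: eq_bigr => x xU; rewrite /g simple_tab_add.
    by have /forall_inP/(_ x xU)/eqP -> := svalP (tabP c).
  rewrite (mean_ffun_prod (fun x v => if x \in U then G x (simple_tab T (y x) + v) else 1)).
  rewrite [RHS]big_mkcond; apply: eq_bigr => x _; case: ifP => _; last first.
    exact: mean_cst (bits_gt0 r).
  exact: mean_addl.
by rewrite mean_cst //; apply/card_gt0P; exists [ffun=> [ffun=> 0]].
Qed.

End LinearIndependence.

(** * Translations of the tornado tables *)

Section Tornado.
Variables (c d k r : nat).
Hypothesis c_gt0 : (0 < c)%N.
Notation key := (c.-tuple (bits k)).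
Notation tor := (tornado c d k r).

Let cd_gt0 : (0 < c + d)%N. Proof. by rewrite addn_gt0 c_gt0. Qed.

Lemma tornado_gt0 : (0 < #|tor|)%N.
Proof.
apply/card_gt0P.
exists ([ffun=> [ffun=> 0]], finfun (fun i : 'I_d => [ffun=> [ffun=> 0]] : simple_tables (c + i) k k),
  [ffun=> [ffun=> 0]]).
by [].
Qed.

Definition add_top (T : simple_tables (c + d) k r) (w : tor) : tor :=
  (w.1, add_tables w.2 T).

Lemma add_top_inj T : injective (add_top T).
Proof.
apply: inv_inj => -[w1 w2]; rewrite /add_top /=; congr (_, _); exact: add_tablesK.
Qed.


Lemma last_char_add_top T w (x : key) : last_char (add_top T w) x = last_char w x.
Proof. by []. Qed.

Lemma tornado_hash_add_top T w (x : key) :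
  tornado_hash (add_top T w) x = tornado_hash w x + simple_tab T (derived_key w x).
Proof. exact: simple_tab_add. Qed.

(** The sum has one term when c + d is positive; writing it so needs no ordinal for the last
    position. *)
Definition last_table (w : tor) : {ffun bits k -> bits r} :=
  [ffun a => \sum_(j < c + d | (j.+1 == c + d)%N) top_tables w j a].

Lemma tornado_hash_hbar w (x : key) :
  tornado_hash w x = (hbar w x).1 + last_table w (hbar w x).2.
Proof.
rewrite !ffunE /= /tornado_hash /simple_tab (bigID (fun j : 'I__ => (j < (c + d).-1)%N)) /=.
congr (_ + _).
have lastE (j : 'I_(c + d)) : ~~ (j < (c + d).-1)%N = (j.+1 == c + d)%N.
  by have := ltn_ord j; move: cd_gt0; lia.
apply: eq_big => [j|j]; rewrite lastE // => /eqP jE.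
have jE' : (c + d).-1 = j := esym (congr1 predn jE).
by rewrite /last_char (tnth_nth 0) [in RHS]jE'.
Qed.

Definition add_last (u : {ffun bits k -> bits r}) (w : tor) : tor :=
  add_top [ffun j : 'I_(c + d) => if (j.+1 == c + d)%N then u else [ffun=> 0]] w.

Lemma hbar_add_last u w : hbar (add_last u w) = hbar w.
Proof.
apply/ffunP => x; rewrite !ffunE; congr (_, _); apply: eq_bigr => j jlt.
rewrite !ffunE ifF ?ffunE ?addr0 //; apply/negbTE; move: jlt cd_gt0; lia.
Qed.

Lemma last_table_add_last u w : last_table (add_last u w) = [ffun a => last_table w a + u a].
Proof.
have lt_last : ((c + d).-1 < c + d)%N by rewrite prednK.
have lastE : (fun j : 'I_(c + d) => j.+1 == c + d)%N =1 pred1 (Ordinal lt_last).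
  by move=> j; rewrite /= -val_eqE /=; move: cd_gt0; lia.
apply/ffunP => a; rewrite !ffunE !(big_pred1 _ lastE) !ffunE /= prednK // eqxx.
by [].
Qed.

(** Translating the last top table leaves [hbar] fixed and shifts [last_table] uniformly, so the two
    are independent and the latter can be averaged first. *)
Lemma mean_last (R : realType) (F : tor -> R)
    (F0 : {ffun key -> bits r * bits k} -> {ffun bits k -> bits r} -> R) :
    (forall w : tor, F w = F0 (hbar w) (last_table w)) ->
  mean F = mean (fun w : tor => mean (F0 (hbar w))).
Proof.
move=> FE; rewrite (@mean_average _ _ _ add_last); first last.
- by move=> u; exact: add_top_inj.
- by rewrite card_ffun expn_gt0 bits_gt0.
apply: eq_mean => w; rewrite -[RHS](mean_inj (g := fun u : {ffun bits k -> bits r} => [ffun a => last_table w a + u a])).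
  by apply: eq_mean => u; rewrite FE hbar_add_last last_table_add_last.
by move=> u u' /ffunP uu'; apply/ffunP => a; move: (uu' a); rewrite !ffunE; exact: addrI.
Qed.

(** Apply [mean_last] to F times the indicator of the conditioning event, which is a function of
    [hbar]. *)
Lemma cond_mean_hbar (R : realType) (F : tor -> R)
    (F0 : {ffun key -> bits r * bits k} -> {ffun bits k -> bits r} -> R) :
    (forall w : tor, F w = F0 (hbar w) (last_table w)) ->
  forall w, cond_mean F (@hbar c d k r) w = mean (F0 (hbar w)).
Proof.
move=> FE w; rewrite /cond_mean.
pose P (w' : tor) : R := (hbar w' == hbar w)%:R.
have N_gt0 : (0 : R) < #|[set w' : tor | hbar w' == hbar w]|%:R.
  by rewrite ltr0n; apply/card_gt0P; exists w; rewrite inE.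
have T_gt0 : (0 : R) < #|tor|%:R by rewrite ltr0n tornado_gt0.
apply: (mulIf (lt0r_neq0 N_gt0)); rewrite divfK ?gt_eqF //.
have -> : \sum_(w' | hbar w' == hbar w) F w' = mean (fun w' => P w' * F w') * #|tor|%:R.
  rewrite divfK ?gt_eqF // big_mkcond; apply: eq_bigr => w' _; rewrite /P.
  by case: eqP; rewrite ?mul1r ?mul0r.
rewrite (@mean_last _ _ (fun b u => (b == hbar w)%:R * F0 b u)) => [|w']; last by rewrite FE.
rewrite (eq_mean (Z := fun w' => mean (F0 (hbar w)) * P w')) => [|w']; last first.
  by rewrite meanZ /P mulrC; case: eqP => [->|]; rewrite ?mulr0.
rewrite meanZ -mulrA; congr (_ * _).
have -> : mean (fun w' => P w') = prob R [set w' : tor | hbar w' == hbar w].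
  by rewrite probE; apply: eq_mean => w'; rewrite inE.
by rewrite /prob divfK // gt_eqF.
Qed.

End Tornado.

(** A cast between table types whose numbers of positions, such as (c + d) - 1 and c + i for the
    last i, are equal but not convertible. *)
Definition resize_tables (m n k r : nat) (T : simple_tables m k r) : simple_tables n k r :=
  [ffun j : 'I_n => if insub (j : nat) is Some j' then T j' else [ffun=> 0]].

Lemma resize_tables_prefix (m n k r : nat) (T : simple_tables m k r) (s s' : seq (bits k)) :
    n = m -> (forall j, (j < m)%N -> s`_j = s'`_j) ->
  simple_tab (resize_tables n T) (prefix_key n s) = simple_tab T (prefix_key m s').
Proof.
move=> nm eq_s; subst n; apply: eq_bigr => j _.
by rewrite ffunE valK !tnth_mktuple eq_s.
Qed.

Section LastDerived.
Variables (c d k r : nat).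
Hypothesis c_gt0 : (0 < c)%N.
Notation key := (c.-tuple (bits k)).
Notation tor := (tornado c d k r).
Notation m := (c + d).-1.

(* Adds T to the tables that compute the character at the last position: those
   of h_0 when d = 0, and those of the last derived character otherwise. *)
Definition add_char (T : simple_tables m k k) (w : tor) : tor :=
  (if d == 0 then add_tables w.1.1 (resize_tables c.-1 T) else w.1.1,
   finfun (fun i : 'I_d => if i.+1 == d
     then add_tables (w.1.2 i) (resize_tables (c + i) T) else w.1.2 i),
   w.2).

Lemma add_char_inj T : injective (add_char T).
Proof.
apply: inv_inj => -[[w0 w1] w2]; rewrite /add_char /=; congr (_, _, _).
  by case: eqP => // _; exact: add_tablesK.
apply/ffunP => i; rewrite !ffunE; case: eqP => // _; exact: add_tablesK.
Qed.

Let step (w : tor) (s : seq (bits k)) (i : 'I_d) :=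
  rcons s (simple_tab (derived_tables w i) (prefix_key (c + i) s)).
Let start (w : tor) (x : key) := rcons (take c.-1 x)
  (x`_c.-1 + simple_tab (h0_tables w) (prefix_key c.-1 x)).

Let partial w x n := foldl (step w) (start w x) (take n (enum 'I_d)).

Let size_start w x : size (start w x) = c.
Proof. by rewrite size_rcons size_takel ?prednK // size_tuple leq_pred. Qed.

Let partialS w x (i : 'I_d) :
  partial w x i.+1 = step w (partial w x i) i.
Proof.
rewrite /partial (take_nth i) ?size_enum_ord // foldl_rcons; congr step.
by rewrite nth_ord_enum.
Qed.

Let size_partial w x n : (n <= d)%N -> size (partial w x n) = (c + n)%N.
Proof.
elim: n => [|n IHn] nd; first by rewrite /partial take0 /= size_start addn0.
by rewrite (partialS w x (Ordinal nd)) size_rcons IHn ?addnS // ltnW.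
Qed.

Let partial_full w x : partial w x d = derived_seq w x.
Proof. by rewrite /partial take_oversize ?size_enum_ord. Qed.

Let nth_last (w : tor) (x : key) : last_char w x = (derived_seq w x)`_m.
Proof.
have lt_m : (m < c + d)%N by rewrite prednK // addn_gt0 c_gt0.
by rewrite /last_char -[in LHS](tnth_nth 0 _ (Ordinal lt_m)) tnth_mktuple.
Qed.

Let nth_derived_key (w : tor) (x : key) j : (j < m)%N -> (derived_key w x)`_j = (derived_seq w x)`_j.
Proof.
move=> jm; have lt_j : (j < c + d)%N by rewrite (leq_trans jm) // leq_pred.
by rewrite -[in LHS](tnth_nth 0 _ (Ordinal lt_j)) tnth_mktuple.
Qed.

Let partial_add_char T w x n : (n < d)%N -> partial (add_char T w) x n = partial w x n.
Proof.
elim: n => [|n IHn] nd.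
  by rewrite /partial take0 /= /start /h0_tables /= gtn_eqF.
have nd' := ltnW nd.
rewrite (partialS _ x (Ordinal nd')) (partialS w x (Ordinal nd')) IHn // /step.
by rewrite /derived_tables ffunE /= ltn_eqF.
Qed.

(** The altered tables are used only in the last step of the construction, and the input of that
    step is the unaltered prefix. *)
Lemma add_charP T (w : tor) (x : key) :
  (forall j, (j < m)%N -> (derived_seq (add_char T w) x)`_j = (derived_seq w x)`_j)
  /\ (derived_seq (add_char T w) x)`_m
     = (derived_seq w x)`_m + simple_tab T (prefix_key m (derived_seq w x)).
Proof.
rewrite -!partial_full; case: (posnP d) => [d0|d_gt0].
  have startE w' : partial w' x d = start w' x by rewrite d0 /partial take0.
  have mE : m = c.-1 by rewrite d0 addn0.
  have size_take : size (take c.-1 x) = c.-1 by rewrite size_takel // size_tuple leq_pred.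
  rewrite !startE /start; split=> [j|].
    by rewrite mE => jm; rewrite !nth_rcons size_take jm.
  rewrite {1 2}mE !nth_rcons size_take ltnn eqxx /h0_tables /= ifT; last exact/eqP.
  rewrite simple_tab_add addrA; congr (_ + _).
  apply: resize_tables_prefix => // j; rewrite mE => jm.
  by rewrite nth_rcons size_take jm nth_take.
have d1 : (d.-1 < d)%N by rewrite prednK.
have dE : partial w x d = step w (partial w x d.-1) (Ordinal d1).
  by rewrite -{1}(prednK d_gt0) (partialS w x (Ordinal d1)).
have dE' : partial (add_char T w) x d = step (add_char T w) (partial w x d.-1) (Ordinal d1).
  by rewrite -{1}(prednK d_gt0) (partialS _ x (Ordinal d1)) /= partial_add_char.
have mE : m = (c + d.-1)%N by lia.
have size_p : size (partial w x d.-1) = m by rewrite size_partial ?leq_pred.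
rewrite dE dE' /step; split=> [j jm|]; first by rewrite !nth_rcons size_p jm.
rewrite !nth_rcons size_p ltnn eqxx /derived_tables ffunE /= prednK // eqxx.
rewrite simple_tab_add; congr (_ + _); apply: resize_tables_prefix => // j jm.
by rewrite nth_rcons size_p jm.
Qed.

Lemma last_char_add_char T (w : tor) (x : key) :
  last_char (add_char T w) x
  = last_char w x + simple_tab T (prefix_key m (derived_key w x)).
Proof.
rewrite !nth_last (add_charP T w x).2; congr (_ + simple_tab T _).
by apply: eq_from_tnth => j; rewrite !tnth_mktuple nth_derived_key.
Qed.

Lemma prefix_add_char T (w : tor) (x : key) :
  prefix_key m (derived_key (add_char T w) x) = prefix_key m (derived_key w x).
Proof.
apply: eq_from_tnth => j.
by rewrite !tnth_mktuple !nth_derived_key // (add_charP T w x).1.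
Qed.

End LastDerived.

(** * Selected keys with independent prefixes *)

(** An even subfamily of K is carried by f, injective there, to an even subfamily of X. This passes
    from the selected set to indexed choices of selected keys. *)
Lemma lin_indep_imset (k m : nat) (I J : finType) (X : {set I}) (K : {set J})
    (y : I -> m.-tuple (bits k)) (f : J -> I) :
    lin_indep X y -> {in K &, injective f} -> (forall j, j \in K -> f j \in X) ->
  lin_indep K (y \o f).
Proof.
move=> indep f_inj fX; apply: contra indep => /existsP[B /and3P[BK B0 even_B]].
apply/existsP; exists (f @: B); apply/and3P; split.
- by apply/subsetP => _ /imsetP[j jB ->]; apply/fX/(subsetP BK).
- by case/set0Pn: B0 => j jB; apply/set0Pn; exists (f j); rewrite imset_f.
apply/forallP => a; move/forallP: even_B => /(_ a); congr (~~ odd _).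
have -> : [set i in f @: B | a \in position_chars (y i)]
    = f @: [set j in B | a \in position_chars ((y \o f) j)].
  apply/setP => i; rewrite inE; apply/andP/imsetP => [[/imsetP[j jB ->] aj]|[j]].
    by exists j; rewrite // inE jB.
  by rewrite inE => /andP[jB aj] ->; rewrite imset_f.
rewrite card_in_imset // => j j'; rewrite !inE => /andP[jB _] /andP[j'B _].
by apply: f_inj; exact: (subsetP BK).
Qed.

(** A subfamily that is even at all m positions is even at the first n. *)
Lemma lin_indep_prefix (k m n : nat) (I : finType) (U : {set I})
    (y : I -> m.-tuple (bits k)) :
    (n <= m)%N -> lin_indep U (fun x => prefix_key n (y x)) -> lin_indep U y.
Proof.
move=> nm; apply: contra => /existsP[B /and3P[BU B0 even_B]].
apply/existsP; exists B; rewrite BU B0 /=; apply/forallP => -[j b].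
move/forallP: even_B => /(_ (widen_ord nm j, b)); congr (~~ odd #|pred_of_set _|).
apply/setP => i; rewrite !inE; congr (_ && _).
by rewrite !mem_position_chars /= tnth_mktuple (tnth_nth 0).
Qed.

Section Moments.
Variables (R : realType) (c d k r : nat).
Hypothesis c_gt0 : (0 < c)%N.
Notation key := (c.-tuple (bits k)).
Notation tor := (tornado c d k r).
Notation m := (c + d).-1.
Variable phi : key -> bits r -> bool.

Let n : R := sigma_card R k.
Let prefix (w : tor) (x : key) := prefix_key m (derived_key w x).

Definition select_prob (x : key) : R := mean (fun v : bits r => (phi x v)%:R).

Lemma select_prob_ge0 x : 0 <= select_prob x.
Proof. by apply: mean_ge0 => v; rewrite ler0n. Qed.

Lemma sigma_card_gt0 : 0 < n.
Proof. by rewrite ltr0n bits_gt0. Qed.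

(* Translating the top tables randomizes the hash values, then translating the
   tables of the last character randomizes that character; neither changes the
   prefixes. *)
Lemma mean_indep_selected (J : finType) (K : {set J}) (f : J -> key) (a : J -> bits k) :
  mean (fun w : tor => (lin_indep K (prefix w \o f))%:R
     * \prod_(j in K) (f j \in selected_last phi w (a j))%:R)
  <= \prod_(j in K) (select_prob (f j) / n).
Proof.
have tables_gt0 m' r' : (0 < #|simple_tables m' k r'|)%N.
  by apply/card_gt0P; exists [ffun=> [ffun=> 0]].
pose ind (w : tor) : R := (lin_indep K (prefix w \o f))%:R.
pose P := \prod_(j in K) select_prob (f j).
have P_ge0 : 0 <= P by apply: prodr_ge0 => j _; exact: select_prob_ge0.
have top : mean (fun w : tor => ind w * \prod_(j in K) (f j \in selected_last phi w (a j))%:R)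
    = mean (fun w : tor => P * (ind w * \prod_(j in K) (last_char w (f j) == a j)%:R)).
  rewrite (mean_average _ (tables_gt0 (c + d)%N r) (@add_top_inj c d k r)).
  apply: eq_mean => w.
  rewrite (eq_mean (Z := fun T => (ind w * \prod_(j in K) (last_char w (f j) == a j)%:R)
      * \prod_(j in K) (phi (f j) (tornado_hash w (f j) + simple_tab T (derived_key w (f j))))%:R));
    last first.
    move=> T; rewrite -mulrA; congr (_ * _); rewrite -big_split /=; apply: eq_bigr => j _.
    by rewrite !inE tornado_hash_add_top last_char_add_top -natrM mulnb andbC.
  rewrite meanZ mulrC /ind; case: (boolP (lin_indep _ _)) => [indep|]; last by rewrite !mul0r !mulr0.
  have indep_key : lin_indep K (fun j => derived_key w (f j)).
    exact: lin_indep_prefix (leq_pred _) indep.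
  rewrite (lin_indep_uniform indep_key
    (fun j v => (phi (f j) (tornado_hash w (f j) + v))%:R)).
  congr (_ * _); apply: eq_bigr => j _.
  exact: (mean_addl (tornado_hash w (f j)) (fun v => (phi (f j) v)%:R : R)).
rewrite -/(ind _) top meanZ big_split /= prodr_const ler_wpM2l //.
rewrite (mean_average _ (tables_gt0 m k) (@add_char_inj c d k r)).
rewrite -[leRHS](mean_cst _ (tornado_gt0 c d k r)); apply: le_mean => w.
rewrite (eq_mean (Z := fun T => ind w
    * \prod_(j in K) (last_char w (f j) + simple_tab T (prefix w (f j)) == a j)%:R)); last first.
  move=> T; rewrite /ind /prefix; congr (_ %:R * _).
    congr (~~ _); apply: eq_existsb => B; congr [&& _, _ & _].
    by apply: eq_forallb => b; congr (~~ odd #|pred_of_set _|); apply/setP => j;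
       rewrite !inE /= prefix_add_char.
  by apply: eq_bigr => j _; rewrite last_char_add_char.
rewrite meanZ /ind; case: (boolP (lin_indep _ _)) => [indep|]; last first.
  by rewrite mul0r exprn_ge0 // invr_ge0 ltW ?sigma_card_gt0.
rewrite mul1r (lin_indep_uniform indep (fun j v => (last_char w (f j) + v == a j)%:R)).
rewrite -prodr_const le_eqVlt; apply/orP; left; apply/eqP; apply: eq_bigr => j _.
rewrite (mean_addl (last_char w (f j)) (fun v => (v == a j)%:R)).
by rewrite /mean (bigD1 (a j)) //= eqxx big1 ?addr0 ?mul1r // => v /negPf ->.
Qed.

End Moments.

Lemma sum_option (R : nmodType) (T : finType) (f : option T -> R) :
  \sum_o f o = f None + \sum_t f (Some t).
Proof.
rewrite (bigD1 None) //=; congr (_ + _); rewrite (reindex_omap Some id) /=.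
  by apply: eq_bigl => t; rewrite eqxx.
by case.
Qed.

Lemma sum_injective_ffun (R : nzSemiRingType) (I T : finType) (A : {set T}) :
  \sum_(u : {ffun I -> T}) (injectiveb u && [forall i, u i \in A])%:R
  = (#|A| ^_ #|I|)%:R :> R.
Proof.
rewrite -card_inj_ffuns_on -sum1_card natr_sum [RHS]big_mkcond.
apply: eq_bigr => u _; rewrite inE andbC.
have -> : (u \in ffun_on A) = [forall i, u i \in A].
  by apply/ffun_onP/forallP.
by case: (_ && _).
Qed.

(** * Exponential moments on the event of independence *)

Section ExpMoment.
Variables (R : realType) (c d k r : nat).
Hypothesis c_gt0 : (0 < c)%N.
Notation key := (c.-tuple (bits k)).
Notation tor := (tornado c d k r).
Variable phi : key -> bits r -> bool.
Let n : R := sigma_card R k.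
Notation p := (@select_prob R c k r phi).

Lemma mean_selected (v : bits r) (a : bits k) (x : key) :
  mean (fun u : {ffun bits k -> bits r} => (phi x (v + u a))%:R) = p x.
Proof.
rewrite (mean_ffun_proj (bits_gt0 r) a (fun t => (phi x (v + t))%:R)).
exact: (mean_addl v (fun t => (phi x t)%:R)).
Qed.

(** Given [hbar], each hash value is shifted by a uniform entry of the last table. *)
Lemma mu_sum : mu R d phi = \sum_x p x.
Proof.
rewrite /mu (mean_last c_gt0 (F0 := fun b u => \sum_x (phi x ((b x).1 + u (b x).2))%:R)).
  rewrite (eq_mean (Z := fun=> \sum_x p x)) => [|w]; first by rewrite mean_cst ?tornado_gt0.
  by rewrite mean_sum; apply: eq_bigr => x _; exact: mean_selected.
move=> w; rewrite -sum1_card natr_sum big_mkcond; apply: eq_bigr => x _.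
by rewrite inE (tornado_hash_hbar c_gt0); case: (phi _ _).
Qed.

Variables (i : nat) (D : R).
Hypothesis D_ge0 : 0 <= D.
Let C := D / i`!%:R.
Let C_ge0 : 0 <= C. Proof. by rewrite divr_ge0. Qed.
Notation U := {ffun 'I_i -> key}.

(* Expanding the product over a of the sums of [weight w a] chooses, for every a,
   either nothing or i distinct keys in order; the factor 1 / i! in C compensates
   for the order. *)
Let weight (w : tor) (a : bits k) (o : option U) : R :=
  if o is Some u then C * (injectiveb u && [forall j, u j \in selected_last phi w a])%:R else 1.

Let weight_ge0 w a o : 0 <= weight w a o.
Proof. by case: o => [u|] /=; [exact: mulr_ge0 | exact: ler01]. Qed.

(** If at least i keys are selected at a, they form at least i! injective lists of length i, so the
    weights sum to at least 1 + D. *)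
Let exp_S_le (w : tor) :
  (1 + D) ^+ S_ phi i w <= \prod_a \sum_o weight w a o.
Proof.
rewrite /S_ -prodr_const big_mkcond; apply: ler_prod => a _.
rewrite sum_option /= -mulr_sumr sum_injective_ffun card_ord inE.
case: ifP => [le_i|_]; last by rewrite ler01 lerDl mulr_ge0.
rewrite addr_ge0 //= lerD2l /C -mulrA ler_peMr // ler_pdivlMl ?ltr0n ?fact_gt0 //.
by rewrite mulr1 ler_nat -bin_ffact leq_pmull // bin_gt0.
Qed.

Let weight_prob (o : option U) : R :=
  if o is Some u then C * \prod_j (p (u j) / n) else 1.

Let x0 : key := [tuple 0 | _ < c].

(** The chosen keys form one family over the pairs (a, j) in [K]; outside [K] the value [x0] is a
    filler. Unless some weight is 0, all of them are selected with the prescribed last characters,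
    so their prefixes are independent and [mean_indep_selected] applies. *)
Let mean_weight (G : {ffun bits k -> option U}) :
  mean (fun w : tor => (w \in J_event d phi)%:R * \prod_a weight w a (G a))
  <= \prod_a weight_prob (G a).
Proof.
pose f (aj : bits k * 'I_i) : key := if G aj.1 is Some u then u aj.2 else x0.
pose K := [set aj : bits k * 'I_i | G aj.1 != None].
pose C' a : R := if G a is Some _ then C else 1.
have C'_ge0 a : 0 <= C' a by rewrite /C'; case: (G a).
have prodK (F : bits k * 'I_i -> R) : \prod_(aj in K) F aj
    = \prod_a (if G a is Some _ then \prod_j F (a, j) else 1).
  rewrite big_mkcond /=.
  rewrite (eq_bigr (fun aj => if (aj.1, aj.2) \in K then F (aj.1, aj.2) else 1)); last by case.
  rewrite -(pair_bigA _ (fun a j => if (a, j) \in K then F (a, j) else 1)) /=.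
  apply: eq_bigr => a _; case Ga : (G a) => [u|].
    by apply: eq_bigr => j _; rewrite inE /= Ga.
  by rewrite big1 // => j _; rewrite inE /= Ga.
have -> : \prod_a weight_prob (G a) = \prod_a C' a * \prod_(aj in K) (p (f aj) / n).
  rewrite prodK -big_split; apply: eq_bigr => a _; rewrite /C' /weight_prob /f /=.
  by case Ga : (G a) => [u|]; rewrite ?mulr1.
apply: le_trans (ler_wpM2l _ (mean_indep_selected R d c_gt0 phi K f fst)); last exact: prodr_ge0.
rewrite -meanZ; apply: le_mean => w.
set rhs := (X in _ <= X).
have rhs_ge0 : 0 <= rhs.
  by rewrite mulr_ge0 ?prodr_ge0 // mulr_ge0 // prodr_ge0.
case: (boolP (w \in J_event d phi)) => [|_]; last by rewrite mul0r.
rewrite mul1r inE => indep.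
have [/existsP [a] | /existsPn all_sel] := boolP [exists a,
    if G a is Some u then ~~ (injectiveb u && [forall j, u j \in selected_last phi w a]) else false].
  rewrite (bigD1 a) //= /weight; case: (G a) => // u /negPf ->.
  by rewrite mulr0 mul0r.
have selP a u : G a = Some u -> injective u /\ forall j, u j \in selected_last phi w a.
  move=> Ga; have := all_sel a; rewrite Ga negbK => /andP[/injectiveP ? /forallP ?].
  by split.
have f_sel aj : aj \in K -> f aj \in selected_last phi w aj.1.
  rewrite inE /f; case Ga : (G aj.1) => [u|] // _; exact: (selP _ _ Ga).2.
have -> : \prod_a weight w a (G a) = \prod_a C' a.
  apply: eq_bigr => a _; rewrite /C'; case Ga : (G a) => [u|] //=.
  have [/injectiveP -> u_sel] := selP _ _ Ga.
  by rewrite (introT forallP u_sel) mulr1.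
rewrite /rhs (lin_indep_imset indep) => [||aj /f_sel]; last by rewrite inE => /andP[].
  by rewrite mul1r [X in _ * X]big1 ?mulr1 // => aj aK; rewrite f_sel.
(* Equal keys have equal last characters, so a = a'; the list chosen at a is injective, so j =
   j'. *)
move=> [a j] [a' j'] aK a'K eqf.
have := f_sel _ aK; have := f_sel _ a'K; rewrite -eqf /= !inE.
move=> /andP[_ /eqP last_a'] /andP[_ /eqP last_a].
have aa' : a = a' by rewrite -[LHS]last_a -[RHS]last_a'.
move: aK eqf; rewrite -aa' inE /f /=; case Ga : (G _) => [u|] // _ eqf.
by congr (_, _); apply: (selP _ _ Ga).1.
Qed.

(** Expand by [exp_S_le], bound each choice by [mean_weight] and fold the sums back; the sum over
    lists of i keys becomes (mu / n)^i by [mu_sum]. *)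
Lemma exp_moment_le :
  mean (fun w : tor => (w \in J_event d phi)%:R * (1 + D) ^+ S_ phi i w)
  <= (1 + D * ((mu R d phi / n) ^+ i / i`!%:R)) ^+ #|{: bits k}|.
Proof.
apply: (@le_trans _ _ (mean (fun w : tor =>
    \sum_(G : {ffun bits k -> option U}) (w \in J_event d phi)%:R * \prod_a weight w a (G a)))).
  apply: le_mean => w; rewrite -mulr_sumr ler_wpM2l //.
  by rewrite -(bigA_distr_bigA (weight w)); exact: exp_S_le.
rewrite mean_sum; apply: (@le_trans _ _ (\sum_(G : {ffun bits k -> option U})
    \prod_a weight_prob (G a))); first by apply: ler_sum => G _; exact: mean_weight.
rewrite -(bigA_distr_bigA (fun=> weight_prob)) prodr_const sum_option /= -mulr_sumr.
rewrite -(bigA_distr_bigA (fun=> fun x => p x / n)) prodr_const card_ord -mulr_suml -mu_sum.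
by rewrite /C mulrAC -mulrA.
Qed.

End ExpMoment.

(** * Conditioning on hbar *)

Lemma selection_tail (R : realType) (c d k r : nat) (phi : c.-tuple (bits k) -> bits r -> bool)
    (i : nat) (l : R) :
    (0 < c)%N -> 0 < l -> l <= mubar R d phi i ->
  prob R ([set w : tornado c d k r |
      mubar R d phi i + Num.sqrt (3 * mubar R d phi i * l) <= (S_ phi i w)%:R]
    :&: J_event d phi) < expR (- l).
Proof.
move=> c_gt0 l_gt0 l_le; set M := mubar R d phi i.
have M_gt0 : 0 < M by exact: lt_le_trans l_le.
(* Then M x is the required deviation, M x^2 / 3 = l, and l <= M becomes x^2 <= 3, the range of
   [chernoff_rate_gt]. *)
pose x := Num.sqrt (3 * l / M).
have x2 : x ^+ 2 = 3 * l / M.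
  by rewrite sqr_sqrtr //; apply: divr_ge0; [apply: mulr_ge0 => //|]; exact: ltW.
have x_gt0 : 0 < x by rewrite sqrtr_gt0; apply: divr_gt0 => //; exact: mulr_gt0.
have x2_le3 : x ^+ 2 <= 3 by rewrite x2 ler_pdivrMr // ler_pM2l.
have -> : Num.sqrt (3 * M * l) = M * x.
  have -> : 3 * M * l = (M * x) ^+ 2 by rewrite exprMn x2; field; rewrite gt_eqF.
  by rewrite sqrtr_sqr gtr0_norm //; exact: mulr_gt0.
have x1_gt0 : 0 < 1 + x by lra.
have rate := chernoff_rate_gt x_gt0 x2_le3.
set t := M + M * x.
apply: (@le_lt_trans _ _ (mean (fun w : tornado c d k r =>
    expR (- (t * ln (1 + x))) * ((w \in J_event d phi)%:R * (1 + x) ^+ S_ phi i w)))).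
  apply: markov_prob => w.
    by rewrite mulr_ge0 ?expR_ge0 // mulr_ge0 // exprn_ge0 // ltW.
  rewrite inE => /andP[]; rewrite inE => tS ->.
  rewrite mul1r -[in X in X ^+ _](@lnK _ (1 + x)) ?posrE // -expRM_natl -expRD.
  rewrite -[leLHS]expR0 ler_expR -mulNr -mulrDl; apply: mulr_ge0; first by rewrite addrC subr_ge0.
  by rewrite ln_ge0 // lerDl ltW.
rewrite meanZ.
have S_le := exp_moment_le (R := R) d c_gt0 phi i (ltW x_gt0).
apply: (@le_lt_trans _ _ (expR (- (t * ln (1 + x))) * expR (x * M))).
  rewrite ler_wpM2l ?expR_ge0 //; apply: le_trans S_le _.
  set q := (_ / i`!%:R).
  have ME : M = sigma_card R k * q by rewrite /M /mubar /f_ mulrA.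
  have q_ge0 : 0 <= q.
    by rewrite -(pmulr_rge0 _ (sigma_card_gt0 R k)) -ME ltW.
  have -> : x * M = (x * q) * #|{: bits k}|%:R by rewrite ME /sigma_card; ring.
  rewrite expRM_natr ler_pXn2r ?nnegrE ?expR_ge0 ?expR_ge1Dx ?bits_gt0 //.
  by rewrite addr_ge0 // mulr_ge0 // ltW.
rewrite -expRD ltr_expR /t.
have -> : - l = - (M * (x ^+ 2 / 3)) by rewrite x2; field; rewrite gt_eqF.
suff num (a y e : R) : 0 < a -> y ^+ 2 / 3 < (1 + y) * e - y ->
  - ((a + a * y) * e) + y * a < - (a * (y ^+ 2 / 3)) by exact: num.
by clear => a_gt0; rewrite -(ltr_pM2l a_gt0); lra.
Qed.

Section Conditional.
Variables (R : realType) (c k r : nat).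
Notation key := (c.-tuple (bits k)).
Variable phi : key -> bits r -> bool.
Variable b : {ffun key -> bits r * bits k}.
Let n : R := sigma_card R k.

(** Given hbar = b, this is |X_a| as a function of the single entry v at a of the last top table;
    distinct a use distinct entries. *)
Definition load (a : bits k) (v : bits r) : nat :=
  #|[set x | phi x ((b x).1 + v) && ((b x).2 == a)]|.

Definition load_ge (i : nat) (a : bits k) (v : bits r) : R := (i <= load a v)%:R.

Definition mean_load_ge (i : nat) : R := \sum_a mean (load_ge i a).

Definition load_min3 (a : bits k) (v : bits r) : R :=
  load_ge 1 a v + load_ge 2 a v + load_ge 3 a v.

Lemma load_min3_sqr a v :
  load_min3 a v ^+ 2 = load_min3 a v + 2 * load_ge 2 a v + 4 * load_ge 3 a v.
Proof.
rewrite /load_min3 /load_ge; case: (load a v) => [|[|[|s]]] /=; ring.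
Qed.

Lemma variance_load_min3 (y := \sum_a mean (load_min3 a)) :
  \sum_a (mean (fun v => load_min3 a v ^+ 2) - mean (load_min3 a) ^+ 2)
  <= y + 2 * mean_load_ge 2 + 4 * mean_load_ge 3 - y ^+ 2 / n.
Proof.
have n_gt0 : 0 < n := sigma_card_gt0 R k.
rewrite sumrB lerB //.
  rewrite /y /mean_load_ge !mulr_sumr -!big_split /= ler_sum // => a _.
  rewrite (eq_mean (load_min3_sqr a)) meanD meanD !meanZ.
  by [].
rewrite ler_pdivrMr //.
(* Cauchy-Schwarz as nonnegativity of the squared deviations, scaled by n to avoid dividing. *)
have dev : 0 <= \sum_a (n * mean (load_min3 a) - y) ^+ 2.
  by apply: sumr_ge0 => a _; exact: sqr_ge0.
have devE : \sum_a (n * mean (load_min3 a) - y) ^+ 2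
    = n * (n * \sum_a mean (load_min3 a) ^+ 2 - y ^+ 2).
  rewrite (eq_bigr (fun a => n ^+ 2 * mean (load_min3 a) ^+ 2
      + (- 2 * n * y) * mean (load_min3 a) + y ^+ 2)) => [|a _]; last by ring.
  rewrite !big_split /= sumr_const -!mulr_sumr -/y -[y ^+ 2 *+ _]mulr_natl.
  by rewrite -/n; ring.
by move: dev; rewrite devE pmulr_rge0 // subr_ge0 mulrC.
Qed.

(** The load truncated at 3 is at most the load, and each key x counts only at its own last
    character. *)
Lemma mean_load_min3_le : \sum_a mean (load_min3 a) <= \sum_x @select_prob R c k r phi x.
Proof.
have -> : \sum_x @select_prob R c k r phi x
    = \sum_a mean (fun v => \sum_x (phi x ((b x).1 + v) && ((b x).2 == a))%:R : R).
  under [RHS]eq_bigr do rewrite mean_sum.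
  rewrite exchange_big /=; apply: eq_bigr => x _.
  rewrite (bigD1 (b x).2) //= big1 => [|a /negPf neq_a]; last first.
    rewrite (eq_mean (Z := fun=> 0)) ?mean_cst ?bits_gt0 // => v.
    by rewrite eq_sym neq_a andbF.
  rewrite addr0 eqxx -[LHS](mean_addl (b x).1).
  by apply: eq_mean => v; rewrite andbT.
apply: ler_sum => a _; apply: le_mean => v.
have -> : \sum_x (phi x ((b x).1 + v) && ((b x).2 == a))%:R = (load a v)%:R :> R.
  rewrite /load -sum1_card natr_sum [RHS]big_mkcond; apply: eq_bigr => x _.
  by rewrite inE; case: (_ && _).
rewrite /load_min3 /load_ge -!natrD ler_nat.
by case: (load a v) => [|[|[|s]]].
Qed.

End Conditional.

(** * Exceptional values of hbar and the variance budget *)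

Lemma S_load (c d k r : nat) (phi : c.-tuple (bits k) -> bits r -> bool)
    (i : nat) (w : tornado c d k r) : (0 < c)%N ->
  S_ phi i w = #|[set a | (i <= load phi (hbar w) a (last_table w a))%N]|.
Proof.
move=> c_gt0; congr #|pred_of_set _|; apply/setP => a; rewrite !inE; congr (_ <= _)%N.
congr #|pred_of_set _|; apply/setP => x; rewrite !inE (tornado_hash_hbar c_gt0) ffunE /=.
by case: eqP => [->|]; rewrite ?andbT ?andbF.
Qed.

Lemma S_le3_load (R : realType) (c d k r : nat) (phi : c.-tuple (bits k) -> bits r -> bool)
    (w : tornado c d k r) : (0 < c)%N ->
  S_le3 R phi w = \sum_a load_min3 R phi (hbar w) a (last_table w a).
Proof.
move=> c_gt0; rewrite /S_le3 !natrD !S_load // /load_min3 !big_split /=.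
have sumE i : #|[set a | (i <= load phi (hbar w) a (last_table w a))%N]|%:R
    = \sum_a load_ge R phi (hbar w) i a (last_table w a).
  rewrite -sum1_card natr_sum big_mkcond; apply: eq_bigr => a _.
  by rewrite inE /load_ge; case: (_ <= _)%N.
by rewrite !sumE.
Qed.

(** Given [hbar], the median bound is applied at the integer part of the conditional mean E; it
    exceeds E - 1 >= t, so the summand 1 pays for the rounding. *)
Lemma prob_mean_load_ge (R : realType) (c d k r : nat)
    (phi : c.-tuple (bits k) -> bits r -> bool) (i : nat) (t : R) : (0 < c)%N ->
  prob R [set w : tornado c d k r | t + 1 <= mean_load_ge R phi (hbar w) i]
  <= 2 * prob R [set w : tornado c d k r | t <= (S_ phi i w)%:R].
Proof.
move=> c_gt0; rewrite !probE -meanZ.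
pose F0 (b : {ffun c.-tuple (bits k) -> bits r * bits k}) (u : {ffun bits k -> bits r}) : R :=
  2 * (t <= #|[set a | (i <= load phi b a (u a))%N]|%:R)%R%:R.
rewrite [leRHS](mean_last c_gt0 (F0 := F0)) => [|w]; last by rewrite inE S_load.
apply: le_mean => w; rewrite inE.
case: (boolP (t + 1 <= _)) => [le_t|_]; last first.
  by apply: mean_ge0 => u; apply: mulr_ge0.
set E := mean_load_ge _ _ _ _ in le_t.
have E_ge0 : 0 <= E by apply: sumr_ge0 => a _; apply: mean_ge0 => v; rewrite ler0n.
have /andP[k_le lt_k] := truncn_itv E_ge0.
have median := poisson_binomial_median (bits_gt0 r) k_le.
rewrite meanZ -ler_pdivrMl // mulr1; apply: le_trans median _.
rewrite probE; apply: le_mean => u; rewrite inE.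
case: leqP => // le_S; rewrite ler_nat lt0b.
have : (Num.truncn E)%:R <= #|[set a | (i <= load phi (hbar w) a (u a))%N]|%:R :> R.
  by rewrite ler_nat.
by move: lt_k le_t; rewrite -natr1; lra.
Qed.

(** Twice the leading term of E2 is mu^2 / n and cancels against - mu^2 / n; four times that of E3
    is at most mu / 6 since f <= 1/2. The square roots give sqrt 6 and 2 times sqrt (l / n) mu, and
    the added ones give 2 + 4 = 6. *)
Lemma variance_budget (R : realType) (n mu l y E2 E3 : R) (f := mu / n) :
    0 < n -> 0 < mu -> mu <= n / 2 -> 0 <= l -> 0 <= y <= mu ->
    E2 <= n * f ^+ 2 / 2 + Num.sqrt (3 * (n * f ^+ 2 / 2) * l) + 1 ->
    E3 <= n * f ^+ 3 / 6 + Num.sqrt (3 * (n * f ^+ 3 / 6) * l) + 1 ->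
  y + 2 * E2 + 4 * E3 - y ^+ 2 / n
  <= 7 / 6 * mu + (2 + Num.sqrt 6) * Num.sqrt (l / n) * mu + 6.
Proof.
move=> n0 mu0 mun l0 /andP[y0 ymu].
have f_gt0 : 0 < f by rewrite divr_gt0.
have f_le : f <= 2^-1 by rewrite ler_pdivrMr // mulrC.
have muE : mu = f * n by rewrite divfK // gt_eqF.
clearbody f; subst mu.
set s := Num.sqrt (l / n); have s0 : 0 <= s by exact: sqrtr_ge0.
have s2 : s ^+ 2 = l / n by rewrite sqr_sqrtr // divr_ge0 // ltW.
have lE : l = s ^+ 2 * n by rewrite s2 divfK // gt_eqF.
set q := Num.sqrt 6; have q0 : 0 <= q :> R by exact: sqrtr_ge0.
have q2 : q ^+ 2 = 6 by rewrite sqr_sqrtr.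
clearbody s q; subst l.
have P0 : 0 <= f * n * s := mulr_ge0 (mulr_ge0 (ltW f_gt0) (ltW n0)) s0.
have -> : Num.sqrt (3 * (n * f ^+ 2 / 2) * (s ^+ 2 * n)) = q / 2 * (f * n * s).
  have -> : 3 * (n * f ^+ 2 / 2) * (s ^+ 2 * n) = (q / 2 * (f * n * s)) ^+ 2.
    by rewrite [RHS]exprMn [(q / 2) ^+ 2]exprMn q2; field.
  by rewrite sqrtr_sqr ger0_norm // mulr_ge0 ?divr_ge0.
have sqrt3 : Num.sqrt (3 * (n * f ^+ 3 / 6) * (s ^+ 2 * n)) <= 2^-1 * (f * n * s).
  have -> : 2^-1 * (f * n * s) = Num.sqrt ((2^-1 * (f * n * s)) ^+ 2).
    by rewrite sqrtr_sqr ger0_norm // mulr_ge0 ?invr_ge0.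
  apply: ler_wsqrtr.
  have -> : 3 * (n * f ^+ 3 / 6) * (s ^+ 2 * n) = f / 2 * (f * n * s) ^+ 2 by field.
  by rewrite [leRHS]exprMn ler_wpM2r ?sqr_ge0 //; lra.
move: (Num.sqrt _) sqrt3 => r3 sqrt3 E2_le E3_le.
(* The map y - y^2 / n is nondecreasing up to n / 2, and y <= mu <= n / 2. *)
have y_le : y - y ^+ 2 / n <= f * n - f ^+ 2 * n.
  have -> : f * n - f ^+ 2 * n = y - y ^+ 2 / n + (f * n - y) * (1 - f - y / n).
    by field; rewrite gt_eqF.
  rewrite lerDl mulr_ge0 ?subr_ge0 // lerBrDl addrC.
  have : y / n <= f by rewrite ler_pdivrMr.
  by lra.
have f3 : n * f ^+ 3 <= n * f / 4.
  by have := mulr_gt0 n0 f_gt0; rewrite -mulrA ler_pM2l // exprS; nra.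
by nra.
Qed.

Theorem theorem12 (R : realType) (c d k r : nat) (hc : (0 < c)%N)
    (B : {set 'I_r}) (phi : c.-tuple (bits k) -> bits r -> bool)
    (hphi : selector B phi)
    (hmu : mu R d phi <= sigma_card R k / 2)
    (s_sec p : R) (hs : 0 < s_sec) (hp0 : 0 < p) (hp1 : p < 1)
    (hsec : ln (s_sec / p) <= mubar R d phi 3) :
  prob R [set w : tornado c d k r |
      S_le3 R phi w <=
        cond_mean (S_le3 R phi) (@hbar c d k r) w
        - Num.sqrt (7 / 3 * ln (1 / p) * mu R d phi
                    * (1 + eps3 d phi s_sec p))
        - ln (1 / p)]
  < (1 + 4 / s_sec) * p + 4 * prob R (~: J_event d phi).
Proof.
set ev := [set w | _].
have J_ge0 := prob_ge0 R (~: J_event (c := c) d phi).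
(* If s_sec <= p the right-hand side is at least p + 4, above any probability. Otherwise l is
   positive, as the tail bound requires. *)
have [le_sp|lt_ps] := leP s_sec p.
  apply: le_lt_trans (prob_le1 R ev) _.
  have : 1 <= p / s_sec by rewrite ler_pdivlMr // mul1r.
  have -> : (1 + 4 / s_sec) * p = p + 4 * (p / s_sec) by field; rewrite gt_eqF.
  by lra.
have sp_gt1 : 1 < s_sec / p by rewrite ltr_pdivlMr // mul1r.
set l := ln (s_sec / p) in hsec *; have l_gt0 : 0 < l by rewrite ln_gt0.
have expl : expR (- l) = p / s_sec.
  by rewrite expRN lnK ?posrE ?divr_gt0 // invf_div.
set L := ln (1 / p); have L_gt0 : 0 < L by rewrite ln_gt0 // ltr_pdivlMr // mul1r.
have expL : expR (- L) = p by rewrite expRN lnK ?posrE ?divr_gt0 // invf_div divr1.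
have n_gt0 := sigma_card_gt0 R k.
set n := sigma_card R k in hmu n_gt0 *.
set M := mu R d phi in hmu *.
have f3_gt0 : 0 < mubar R d phi 3 := lt_le_trans l_gt0 hsec.
have M_gt0 : 0 < M.
  rewrite lt_neqAle eq_sym; apply/andP; split; last first.
    by apply: mean_ge0 => w; rewrite ler0n.
  apply: contraTneq f3_gt0 => M0.
  by rewrite /mubar /f_ -/M M0 mul0r expr0n mulr0 mul0r ltxx.
pose f := M / n.
have f_gt0 : 0 < f by rewrite divr_gt0.
have f_le : f <= 2^-1 by rewrite ler_pdivrMr // mulrC.
have mubar2 : mubar R d phi 2 = n * f ^+ 2 / 2 by [].
have mubar3 : mubar R d phi 3 = n * f ^+ 3 / 6 by [].
have l_le2 : l <= mubar R d phi 2.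
  apply: le_trans hsec _; rewrite mubar2 mubar3.
  have : 0 < n * f ^+ 2 by rewrite mulr_gt0 ?exprn_gt0.
  by rewrite exprSr mulrA; nra.
pose t i := mubar R d phi i + Num.sqrt (3 * mubar R d phi i * l).
pose bad i := [set w : tornado c d k r | t i + 1 <= mean_load_ge R phi (hbar w) i].
(* The factor 2 is the price of replacing E[S_i | hbar] by S_i; the tail bound holds only on J, so
   the probability of its complement is added. *)
have bad_lt i : l <= mubar R d phi i ->
    prob R (bad i) < 2 * (p / s_sec) + 2 * prob R (~: J_event (c := c) d phi).
  move=> l_le; apply: le_lt_trans (prob_mean_load_ge d phi i (t i) hc) _.
  have tail := selection_tail hc l_gt0 l_le; rewrite -/(t i) expl in tail.
  set A := [set w | _] in tail *.
  have : prob R A <= prob R (A :&: J_event d phi) + prob R (~: J_event d phi).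
    apply: le_trans (probU _ _ _); apply: probS; apply/subsetP => w wA.
    by rewrite !inE; move: wA; rewrite inE => ->; case: (lin_indep _ _).
  by lra.
pose e := eps3 d phi s_sec p.
(* Chosen so that 2 L (W + L / 2) is the radicand of the theorem; the term L / 2 contained in M e
   covers the subtracted L / 2. *)
pose W := 7 / 6 * (M * (1 + e)) - L / 2.
have Me : M * (1 + e) = M + (2 + Num.sqrt 6) * Num.sqrt (l / n) * M + L / 2 + 6.
  by rewrite /e /eps3 -/M -/n -/l -/L; field; rewrite gt_eqF.
have q_ge0 : 0 <= (2 + Num.sqrt 6) * Num.sqrt (l / n) * M.
  by rewrite mulr_ge0 ?(ltW M_gt0) // mulr_ge0 ?sqrtr_ge0 // addr_ge0 ?sqrtr_ge0.
have W_gt0 : 0 < W by rewrite /W Me; lra.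
pose y (b : {ffun c.-tuple (bits k) -> bits r * bits k}) := \sum_a mean (load_min3 R phi b a).
have cond_y w : cond_mean (S_le3 R phi) (@hbar c d k r) w = y (hbar w).
  rewrite (cond_mean_hbar hc (F0 := fun b u => \sum_a load_min3 R phi b a (u a))).
    rewrite mean_sum; apply: eq_bigr => a _.
    exact: (mean_ffun_proj (bits_gt0 r) a (load_min3 R phi (hbar w) a)).
  by move=> w'; exact: S_le3_load.
pose good b := (mean_load_ge R phi b 2 < t 2 + 1) && (mean_load_ge R phi b 3 < t 3 + 1).
have good_le : prob R (ev :&: [set w | good (hbar w)]) <= p.
  rewrite probE.
  (* Goodness depends on [hbar] alone, so with [hbar] fixed either the event is empty or Bernstein's
     inequality applies to the last table. *)
  pose F0 b (u : {ffun bits k -> bits r}) : R := (good b &&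
    (\sum_a load_min3 R phi b a (u a) <= y b - Num.sqrt (2 * L * (W + L / 2)) - L))%:R.
  rewrite (mean_last hc (F0 := F0)) => [|w]; last first.
    rewrite !inE /F0 andbC cond_y S_le3_load //; congr (_ && (_ <= _ - Num.sqrt _ - _))%:R.
    by rewrite /W -/L -/M -/e; field.
  rewrite -[leRHS](mean_cst _ (tornado_gt0 c d k r)); apply: le_mean => w.
  rewrite /F0; case: (boolP (good (hbar w))) => [/andP[/ltW E2 /ltW E3]|_] /=; last first.
    by rewrite mean_cst ?ltW // card_ffun expn_gt0 bits_gt0.
  rewrite -[leRHS]expL.
  have Z_ge0 a v : 0 <= load_min3 R phi (hbar w) a v by rewrite !addr_ge0.
  have Z_le3 a v : load_min3 R phi (hbar w) a v <= 3.
    rewrite /load_min3 /load_ge -!natrD ler_nat.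
    by case: (load _ _ _ _) => [|[|[|s]]].
  have y_ge0 : 0 <= y (hbar w) by apply: sumr_ge0 => a _; exact: mean_ge0.
  have y_le : y (hbar w) <= M by rewrite /M (mu_sum R d hc); exact: mean_load_min3_le.
  have varW : \sum_a (mean (fun v => load_min3 R phi (hbar w) a v ^+ 2)
      - mean (load_min3 R phi (hbar w) a) ^+ 2) <= W.
    apply: le_trans (variance_load_min3 _ _ _) _.
    apply: (@le_trans _ _ (7 / 6 * M + (2 + Num.sqrt 6) * Num.sqrt (l / n) * M + 6)).
      by apply: variance_budget; rewrite ?(ltW l_gt0) ?y_ge0 ?y_le.
    by rewrite /W Me; lra.
  have := bernstein_lower_tail (bits_gt0 r) Z_ge0 Z_le3 W_gt0 L_gt0 varW.
  by rewrite probE; apply: le_trans; apply: le_mean => u; rewrite inE.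
(* Union bound: the good part costs p and each of the two bad events costs 2 p / s_sec plus twice
   the probability of failing J. Strictness comes from [bad_lt]. *)
have sub : ev \subset (ev :&: [set w | good (hbar w)]) :|: (bad 2 :|: bad 3).
  apply/subsetP => w w_ev; rewrite !in_setU in_setI w_ev /= !inE /good !ltNge.
  by do 2 case: (_ <= _).
have := bad_lt 2 l_le2; have := bad_lt 3 hsec.
have := probS R sub; have := probU R (ev :&: [set w | good (hbar w)]) (bad 2 :|: bad 3).
have := probU R (bad 2) (bad 3).
have -> : (1 + 4 / s_sec) * p = p + 4 * (p / s_sec) by field; rewrite gt_eqF.
by lra.
Qed.
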